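(* Let $(\Sigma,\rho,\mu)$ be a complete space of homogeneous type with a metrically continuous measure $\mu$, and let $\mathscr{B}_\rho$ be the family of all metric balls. Let $x_0\in\Sigma$, $0<p<\infty$, and $w\in A_{p_0,\mathscr{B}_\rho}$ for some $p_0\in(1,\infty)$. Then a subset $\mathcal{K}\subseteq L^p(\Sigma,w)$ is relatively compact in $L^p(\Sigma,w)$ if and only if the following are satisfied: (i) $\sup_{f\in\mathcal{K}}\|f\|_{L^p(\Sigma,w)}<\infty$; (ii) $\lim_{A\to\infty}\sup_{f\in\mathcal{K}}\|f\mathbf{1}_{\Sigma\setminus B(x_0,A)}\|_{L^p(\Sigma,w)}=0$; (iii) $\displaystyle\lim_{r\to0}\sup_{f\in\mathcal{K}}\int_\Sigma\bigg(\frac1{\mu(B(x,r))}\int_{B(x,r)}|f(x)-f(y)|^{\frac p{p_0}}d\mu(y)\bigg)^{p_0}w(x)\,d\mu(x)=0$.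
   Context: A space of homogeneous type $(\Sigma,\rho,\mu)$ is a metric space $(\Sigma,\rho)$ with a nonnegative Borel measure $\mu$ that is doubling: $0<\mu(2B)\le C_\mu\mu(B)<\infty$ for every ball $B$, where $B(x,r)=\{y:\rho(x,y)<r\}$ and $\lambda B$ is the ball with the same center and $\lambda$ times the radius; $\mathscr{B}_\rho$ is the family of all balls. It is complete if $(\Sigma,\rho)$ is complete. $\mu$ is metrically continuous if $\lim_{y\to x}\mu(B(x,r)\Delta B(y,r))=0$ for all $x\in\Sigma$, $r>0$ ($\Delta$ is symmetric difference). Functions are real-valued. A weight is a measurable $w$ with $0<w<\infty$ a.e.; $L^p(\Sigma,w):=L^p(\Sigma,w\,d\mu)$ (a quasi-Banach space if $p<1$). For $1<p_0<\infty$, $w\in A_{p_0,\mathscr{B}_\rho}$ means $\sup_{B\in\mathscr{B}_\rho}(\frac1{\mu(B)}\int_Bw\,d\mu)(\frac1{\mu(B)}\int_Bw^{1-p_0'}d\mu)^{p_0-1}<\infty$. *)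

(* Defs.v *)
From HB Require Import structures.
From mathcomp Require Import all_boot all_order all_algebra.
From mathcomp Require Import all_classical all_reals all_analysis.
From mathcomp Require Import measurable_realfun.

Set Implicit Arguments.
Unset Strict Implicit.
Unset Printing Implicit Defensive.

Import Order.TTheory GRing.Theory Num.Theory.
Import numFieldNormedType.Exports.

Local Open Scope classical_set_scope.
Local Open Scope ring_scope.

(* Complete includes a base point, so these spaces are nonempty. *)
#[short(type="completeMetricType")]
HB.structure Definition CompleteMetric (R : numDomainType) :=
  {T of Metric R T & Complete T}.

Notation borel T := (g_sigma_algebraType (@open T)).

Section homogeneous_type.
Context (R : realType) (S : completeMetricType R).
Variable mu : {measure set (borel S) -> \bar R}.
Local Open Scope ereal_scope.

Definition doubling := exists C : R, forall (x : S) (r : R), (0 < r)%R ->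
  [/\ 0 < mu (ball x (2 * r)%R),
      mu (ball x (2 * r)%R) <= C%:E * mu (ball x r) &
      mu (ball x r) < +oo].

Definition metrically_continuous := forall (x : S) (r : R), (0 < r)%R ->
  mu (ball x r `+` ball y r) @[y --> x] --> 0.

Definition balls : set (set S) :=
  [set B | exists x : S, exists2 r : R, (0 < r)%R & B = ball x r].

Definition average (B : set S) (g : borel S -> \bar R) : \bar R :=
  (mu B)^-1 * \int[mu]_(y in B) g y.

Definition conj_exponent (q : R) : R := q / (q - 1).

(* +oo `^ r = +oo and 0 `^ r = 0 for r < 0: the power deviates from the usual
   conventions only where w is 0 or +oo, a null set for a weight. *)
Definition muckenhoupt (q : R) (w : borel S -> \bar R) :=
  ereal_sup [set average B w *
      average B (fun x => w x `^ (1 - conj_exponent q)%R) `^ (q - 1)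
    | B in balls] < +oo.

End homogeneous_type.

Record weight d (T : measurableType d) (R : realType)
    (mu : {measure set T -> \bar R}) := Weight {
  weight_fun :> T -> \bar R ;
  measurable_weight : measurable_fun setT weight_fun ;
  weight_ae : {ae mu, forall x, (0 < weight_fun x < +oo)%E} }.

Section weighted_measure.
Context d (T : measurableType d) (R : realType).
Variables (mu : {measure set T -> \bar R}) (w : weight mu).
Local Open Scope ereal_scope.

(* w may be negative on a null set: the positive part, equal to w almost
   everywhere, makes the set function nonnegative on every set. *)
Definition weighted_measure (A : set T) : \bar R := \int[mu]_(x in A) w^\+ x.

Let weighted_measure0 : weighted_measure set0 = 0.
Proof. exact: integral_set0. Qed.

Let weighted_measure_ge0 A : 0 <= weighted_measure A.
Proof. by apply: integral_ge0 => x _; exact: funepos_ge0. Qed.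

Let weighted_measure_sigma_additive : semi_sigma_additive weighted_measure.
Proof.
move=> F mF tF mUF; rewrite /weighted_measure ge0_integral_bigcup//.
- by apply: is_cvg_ereal_nneg_natsum => n _; apply: integral_ge0 => x _.
- by apply: measurable_funTS; exact/measurable_funepos/measurable_weight.
Qed.

HB.instance Definition _ := isMeasure.Build _ _ _ weighted_measure
  weighted_measure0 weighted_measure_ge0 weighted_measure_sigma_additive.

End weighted_measure.

(* L^p for every exponent 0 < p < oo, as almost-everywhere classes; the
   library's LspaceType requires 1 <= p. *)
Definition Lp d (T : measurableType d) (R : realType)
    (nu : {measure set T -> \bar R}) (p : R) (p_gt0 : 0 < p) : Type :=
  {f : {mfun_ nu, T >-> measurableTypeR R} | finite_norm nu p%:E f}.

Section Lp_uniform.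
Context d (T : measurableType d) (R : realType).
Variables (nu : {measure set T -> \bar R}) (p : R) (p_gt0 : 0 < p).
Local Notation Lp := (Lp nu p_gt0).

Definition Lp_fun (f : Lp) : T -> R := sval f.
Coercion Lp_fun : Lp >-> Funclass.

HB.instance Definition _ := Choice.on Lp.

(* For p < 1 the quasi-norm is not subadditive, so its balls generate a
   uniform structure rather than a metric. *)
Definition Lp_entourage : set_system (Lp * Lp) :=
  [set A | exists2 e : R, 0 < e &
    [set fg : Lp * Lp | ('N[nu]_p%:E[EFin \o (fg.1 \- fg.2)%R] < e%:E)%E] `<=` A].

Let Lp_entourage_filter : Filter Lp_entourage.
Proof.
split; first by exists 1.
- move=> A B [e e0 eA] [e' e'0 e'B]; exists (Num.min e e').
    by rewrite lt_min e0.
  move=> fg /= fge; split; [apply: eA|apply: e'B] => /=;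
    by apply: (lt_le_trans fge); rewrite lee_fin ge_min lexx ?orbT.
- by move=> A B AB [e e0 eA]; exists e => //; exact: subset_trans AB.
Qed.

Let Lp_entourage_diagonal A : Lp_entourage A -> diagonal `<=` A.
Proof.
move=> [e e0 eA] [f g] /= fg; apply: eA => /=; rewrite -[g]fg.
rewrite (@eq_Lnorm _ _ _ _ _ _ (cst 0%E)); last by move=> x /=; rewrite subrr.
by rewrite Lnorm0 ?lte_fin// eqe gt_eqF.
Qed.

Let Lp_entourage_inv A : Lp_entourage A -> Lp_entourage A^-1%relation.
Proof.
move=> [e e0 eA]; exists e => // -[f g] /= fge; apply: eA => /=.
rewrite -oppe_Lnorm (@eq_Lnorm _ _ _ _ _ _ (EFin \o (f \- g)%R))//.
by move=> x /=; rewrite opprB.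
Qed.

Let measurable_Lp (f : Lp) : measurable_fun setT (f : T -> R).
Proof. by rewrite /Lp_fun /aqEqMfun_to_fun; exact: (@measurable_funPT _ _ _ _ (repr (sval f))). Qed.

Let Lp_entourage_split A : Lp_entourage A ->
  exists2 B, Lp_entourage B & (B \; B)%relation `<=` A.
Proof.
move=> [e e0 eA].
pose k : R := (2 `^ (p + 1)) `^ p^-1.
have k0 : 0 < k by rewrite !powR_gt0.
pose B := [set fg : Lp * Lp | ('N[nu]_p%:E[EFin \o (fg.1 \- fg.2)%R] <
   (e / k)%:E)%E].
exists B; first by exists (e / k) => //; exact: divr_gt0.
move=> [f g] /= [h fh hg]; apply: eA => /=; move: fh hg; rewrite /B /=.
have pN0 : p != 0 by rewrite gt_eqF.
have p0 := ltW p_gt0.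
have key (u : \bar R) (c : R) : (0 <= u)%E -> 0 <= c ->
    (u `^ p^-1 < c%:E)%E <-> (u < (c `^ p)%:E)%E.
  move=> u0 c0; case: u u0 => [u||]// u0; last first.
    by rewrite /= invr_eq0 (negbTE pN0).
  rewrite /= !lte_fin; rewrite lee_fin in u0.
  split=> [H|H].
    rewrite -[u](@powRr1 R)// -(mulVf pN0) powRrM.
    by rewrite gt0_ltr_powR// ?nnegrE ?powR_ge0.
  rewrite -[c](@powRr1 R)// -(mulfV pN0) powRrM.
  by rewrite gt0_ltr_powR// ?invr_gt0// ?nnegrE ?powR_ge0.
rewrite !unlock => /key-/(_ _ _) fh /key-/(_ _ _) hg.
have ik0 : 0 <= e / k by rewrite ltW// divr_gt0.
have nn (u v : Lp) : (0 <= \int[nu]_x (`|(EFin \o (u \- v)%R) x| `^ p)%E)%E.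
  by apply: integral_ge0 => x _; exact: poweR_ge0.
have {}fh := fh (nn _ _) ik0.
have {}hg := hg (nn _ _) ik0.
apply/key => //; first exact: ltW.
pose a (u v : Lp) (x : T) : \bar R := (`|(EFin \o (u \- v)%R) x| `^ p)%E.
have ma (u v : Lp) : measurable_fun setT (a u v).
  apply: (measurableT_comp (measurable_poweR _)).
  apply: measurableT_comp => //; apply/measurable_EFinP.
  exact: measurable_funB.
have a0 (u v : Lp) x : (0 <= a u v x)%E by exact: poweR_ge0.
have ptw x : (a f g x <= (2 `^ p)%:E * (a f h x + a h g x))%E.
  rewrite /a /= !lee_fin.
  set s := `|f x - h x|; set t := `|h x - g x|.
  have st : `|f x - g x| <= 2 * Num.max s t.
    rewrite (_ : f x - g x = (f x - h x) + (h x - g x)); last first.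
      by rewrite addrA subrK.
    rewrite (le_trans (ler_normD _ _))// mulr_natl mulr2n lerD//.
      by rewrite le_max lexx.
    by rewrite le_max lexx orbT.
  have m0 : 0 <= Num.max s t by rewrite le_max normr_ge0.
  apply: (@le_trans _ _ ((2 * Num.max s t) `^ p)).
    by rewrite ge0_ler_powR// nnegrE// mulr_ge0.
  rewrite powRM// ler_wpM2l ?powR_ge0//.
  by rewrite /Num.max; case: ifPn => _; rewrite ?lerDl ?lerDr powR_ge0.
have -> : e `^ p = 2 `^ p * ((e / k) `^ p + (e / k) `^ p).
  have kp : k `^ p = 2 `^ p * 2.
    rewrite /k -powRrM mulVf// powRr1 ?powR_ge0// powRD ?powRr1//.
    by apply/implyP => _; rewrite pnatr_eq0.
  have -> : (e / k) `^ p = e `^ p / k `^ p.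
    rewrite powRM ?invr_ge0 ?(ltW e0) ?(ltW k0)//.
    by rewrite -[k^-1]powR_inv1 ?(ltW k0)// -powRrM mulN1r powRN.
  by rewrite kp -mulr2n -[_ / _ *+ 2]mulr_natr mulrCA divfK//.
apply: (@le_lt_trans _ _ (\int[nu]_x ((2 `^ p)%:E * (a f h x + a h g x)))%E).
  change (\int[nu]_x a f g x <= \int[nu]_x ((2 `^ p)%:E * (a f h x + a h g x)))%E.
  apply: ge0_le_integral => //.
  by apply: emeasurable_funM => //; exact: emeasurable_funD.
rewrite ge0_integralZl//=; first last.
- by move=> x _; rewrite adde_ge0.
- exact: emeasurable_funD.
rewrite ge0_integralD// EFinM lte_pmul2l ?lte_fin ?powR_gt0//.
by rewrite EFinD lteD.
Qed.

HB.instance Definition _ := @isUniform.Build Lp Lp_entourage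
  Lp_entourage_filter Lp_entourage_diagonal Lp_entourage_inv
  Lp_entourage_split.

End Lp_uniform.

(* The supremum is taken in [0, +oo], so that it is 0 over the empty family. *)
Definition esup_ge0 (R : realType) (I : Type) (K : set I) (F : I -> \bar R) :=
  ereal_sup (0%E |` [set F f | f in K]).

Section conditions.
Context (R : realType) (S : completeMetricType R).
Variables (mu : {measure set (borel S) -> \bar R}).
Variables (w : weight mu) (p : R) (p_gt0 : 0 < p).
Local Notation Lpw := (Lp (weighted_measure w) p_gt0).
Local Open Scope ereal_scope.

Definition Lpw_norm (f : S -> R) : \bar R :=
  'N[weighted_measure w]_p%:E[EFin \o f].

Definition Lpw_bounded (K : set Lpw) := esup_ge0 K Lpw_norm < +oo.

Definition Lpw_vanishing_at_infinity (x0 : S) (K : set Lpw) :=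
  esup_ge0 K (fun f : Lpw => Lpw_norm (f \* \1_(~` ball x0 A))%R)
    @[A --> +oo%R] --> 0.

Definition oscillation (p0 r : R) (f : S -> R) : \bar R :=
  \int[mu]_x
    (average mu (ball (x : S) r) (fun y => (`|f x - f y| `^ (p / p0))%:E) `^ p0
       * w x).

Definition Lpw_equicontinuous (p0 : R) (K : set Lpw) :=
  esup_ge0 K (fun f : Lpw => oscillation p0 r f) @[r --> 0^'+] --> 0.

End conditions.

(* Main.v *)
Require Import Defs.
From HB Require Import structures.
From mathcomp Require Import all_boot all_order all_algebra.
From mathcomp Require Import all_classical all_reals all_analysis.
From mathcomp Require Import measurable_realfun.
From mathcomp Require Import ring lra.

Set Implicit Arguments.
Unset Strict Implicit.
Unset Printing Implicit Defensive.

Import Order.TTheory GRing.Theory Num.Theory.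
Import numFieldNormedType.Exports.

Local Open Scope classical_set_scope.
Local Open Scope ring_scope.

(** Write nu for the measure w dmu and modular f for the integral of |f|^p
    against nu. The modular satisfies the triangle inequality up to the factor
    2^p and defines the topology of L^p(w) for every p > 0 [Lp_nbhsP], so all
    estimates are made on it rather than on the quasi-norm. The quantity of
    condition (iii) is total_osc r f, the integral against nu of the p0-th
    power of mean_osc r f x, which is the mu-mean of |f x - f y|^(p/p0) over
    the ball B(x, r).

    The conditions are sufficient. If x and y lie in one ball of radius r/2,
    averaging a quasi-triangle inequality over that ball gives
    |f x - f y|^p <= K ((mean_osc r f x)^p0 + (mean_osc r f y)^p0), with K
    depending only on p, p0 and the doubling constant of mu
    [dist_le_mean_osc]. Cut B(x0, A) into finitely many cells of this size, and
    on each cell replace f by its value at a point where (mean_osc r f)^p0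
    does not much exceed its nu-average. Integrating the inequality over the
    cells shows that the resulting step function is within a multiple of
    total_osc r f of f on B(x0, A) [cells_approx]. The cells do not depend on
    f, and the coefficients of the step functions are bounded by (i)
    [cells_coef_le]. So, up to an arbitrarily small error, the family lies in
    a bounded part of a finite-dimensional space. An ultrafilter on such a
    family is Cauchy, because bounded coefficients converge along it, and
    L^p(w) is complete; hence the closure is compact
    [finitely_approximable_precompact].

    The conditions are necessary. Each of them asks for a property of all f in
    K that holds eventually in a parameter. By compactness it is enough that
    every f in L^p(w) has a neighbourhood on which the property holds
    eventually [precompact_Lp_near]. For (iii) two facts give this. First,
    total_osc r h <= K modular h with K independent of r
    [total_osc_le_modular]: by Hoelder, the A_p0 condition says that the
    p0-th power of the mu-mean of g >= 0 over a ball is at most a constant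
    times the nu-mean of g^p0 [muckenhoupt_ball_mean]; in particular nu is
    doubling, and Tonelli turns the bound on single balls into one for the
    averaging operator on L^p0(w) [averaging_bound]. Second, total_osc r f
    tends to 0 with r for every single f in L^p(w)
    [finite_modular_vanishing]: the functions with this property are stable
    under linear combinations and, by the first fact, under approximation in
    the modular; among them are the Lipschitz functions with bounded support,
    then in turn the indicators of bounded open sets, those of bounded Borel
    sets, the simple functions with bounded support, and all of L^p(w). *)

(** * The modular of L^p *)

Section modular.
Context d (T : measurableType d) (R : realType).
Variables (nu : {measure set T -> \bar R}) (p : R).
Hypothesis p_gt0 : 0 < p.
Implicit Types f g h : T -> R.
Local Open Scope ereal_scope.

Definition modular f : \bar R := \int[nu]_x (`|f x| `^ p)%:E.

Lemma modular_ge0 f : 0 <= modular f.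
Proof. by apply: integral_ge0 => x _; rewrite lee_fin powR_ge0. Qed.

Lemma measurable_norm_powR (q : R) f : measurable_fun setT f ->
  measurable_fun setT (fun x => (`|f x| `^ q)%:E).
Proof.
move=> mf; apply/measurable_EFinP.
by apply: (measurableT_comp (measurable_powR _)) => //; exact: measurableT_comp.
Qed.
Hint Resolve modular_ge0 : core.
Hint Resolve measurable_norm_powR : core.

Lemma Lnorm_modular f : 'N[nu]_p%:E[EFin \o f] = modular f `^ p^-1.
Proof. by rewrite unlock. Qed.

Lemma Lnorm_lt f (c : R) : (0 <= c)%R ->
  'N[nu]_p%:E[EFin \o f] < c%:E <-> modular f < (c `^ p)%:E.
Proof.
move=> c0; rewrite Lnorm_modular; have pN0 : p != 0%R by rewrite gt_eqF.
have p0 := ltW p_gt0.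
move: (modular_ge0 f); case: (modular f) => [u||]// u0; last first.
  by rewrite poweRyr ?invr_eq0.
rewrite poweR_EFin !lte_fin; rewrite lee_fin in u0.
split=> [H|H].
  rewrite -[u](@powRr1 R)// -(mulVf pN0) powRrM.
  by rewrite gt0_ltr_powR// ?nnegrE ?powR_ge0.
rewrite -[c](@powRr1 R)// -(mulfV pN0) powRrM.
by rewrite gt0_ltr_powR// ?invr_gt0// ?nnegrE ?powR_ge0.
Qed.

Lemma Lnorm_lty f : 'N[nu]_p%:E[EFin \o f] < +oo <-> modular f < +oo.
Proof.
rewrite Lnorm_modular; split; last exact: poweR_lty.
by apply: lty_poweRy; rewrite invr_eq0 gt_eqF.
Qed.

Lemma modular_le f g : measurable_fun setT f -> measurable_fun setT g ->
  (forall x, `|f x| <= `|g x|)%R -> modular f <= modular g.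
Proof.
move=> mf mg fg; apply: ge0_le_integral => //; try exact: measurable_norm_powR.
by move=> x _; rewrite lee_fin ge0_ler_powR ?nnegrE// ltW.
Qed.

Lemma modular_ae f g : measurable_fun setT f -> measurable_fun setT g ->
  f = g %[ae nu] -> modular f = modular g.
Proof.
move=> mf mg fg; apply: ge0_ae_eq_integral => //; try exact: measurable_norm_powR.
by apply: filterS fg => x /= fg xT; rewrite fg.
Qed.

Lemma modularBC f g : modular (f \- g)%R = modular (g \- f)%R.
Proof. by apply: eq_integral => x _ /=; rewrite distrC. Qed.

Lemma modularZ (a : R) f : measurable_fun setT f ->
  modular (fun x => a * f x)%R = (`|a| `^ p)%:E * modular f.
Proof.
move=> mf; rewrite -ge0_integralZl//=; first last.
  exact: measurable_norm_powR.
by apply: eq_integral => x _; rewrite normrM powRM// EFinM.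
Qed.

Lemma modular0 : modular (cst 0%R) = 0.
Proof.
rewrite -(integral0 nu setT); apply: eq_integral => x _ /=.
by rewrite normr0 powR0// gt_eqF.
Qed.

End modular.

(** Bounding |a + b| by twice the larger of |a| and |b| covers the exponents
    above and below 1 at once. *)
Lemma powR_normD (R : realType) (s a b : R) : 0 <= s ->
  `|a + b| `^ s <= 2 `^ s * (`|a| `^ s + `|b| `^ s).
Proof.
move=> s0.
have st : `|a + b| <= 2 * Num.max `|a| `|b|.
  rewrite (le_trans (ler_normD _ _))// mulr_natl mulr2n lerD//.
    by rewrite le_max lexx.
  by rewrite le_max lexx orbT.
have m0 : 0 <= Num.max `|a| `|b| by rewrite le_max normr_ge0.
apply: (@le_trans _ _ ((2 * Num.max `|a| `|b|) `^ s)).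
  by rewrite ge0_ler_powR// nnegrE// mulr_ge0.
rewrite powRM// ler_wpM2l ?powR_ge0//.
by rewrite /Num.max; case: ifPn => _; rewrite ?lerDl ?lerDr powR_ge0.
Qed.

Lemma poweRD_le (R : realType) (s : R) (a b : \bar R) : 0 <= s ->
  (0 <= a -> 0 <= b -> (a + b) `^ s <= (2 `^ s)%:E * (a `^ s + b `^ s))%E.
Proof.
move=> s0; have [->|sN0] := eqVneq s 0.
  by move=> _ _; rewrite !poweRe0 powRr0 mul1e leeDl.
have s_gt0 : 0 < s by rewrite lt_neqAle eq_sym sN0.
case: a => [a||]// a0; case: b => [b||]// b0.
- rewrite lee_fin in a0; rewrite lee_fin in b0.
  rewrite -EFinD !poweR_EFin -EFinD -EFinM lee_fin.
  have := powR_normD a b s0.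
  by rewrite !ger0_norm ?addr_ge0.
- rewrite !poweRyr// addey; last by rewrite -ltNye (lt_le_trans _ (poweR_ge0 _ _)).
  by rewrite gt0_muley ?leey// lte_fin powR_gt0.
- rewrite !poweRyr// addye; last by rewrite -ltNye (lt_le_trans _ (poweR_ge0 _ _)).
  by rewrite gt0_muley ?leey// lte_fin powR_gt0.
- by rewrite addye// !poweRyr// addye// gt0_muley ?leey// lte_fin powR_gt0.
Qed.

Section modularD.
Context d (T : measurableType d) (R : realType).
Variables (nu : {measure set T -> \bar R}) (p : R).
Hypothesis p_gt0 : 0 < p.
Implicit Types f g h : T -> R.
Local Open Scope ereal_scope.
Local Notation modular := (modular nu p).

Lemma modularD f g : measurable_fun setT f -> measurable_fun setT g ->
  modular (f \+ g)%R <= (2 `^ p)%:E * (modular f + modular g).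
Proof.
move=> mf mg; rewrite /modular -ge0_integralD//=; first last.
- exact: measurable_norm_powR.
- exact: measurable_norm_powR.
rewrite -ge0_integralZl//=; first last.
- by move=> x _; rewrite lee_fin addr_ge0 ?powR_ge0.
- by apply: emeasurable_funD => //; exact: measurable_norm_powR.
apply: ge0_le_integral => //=.
- by apply: (measurable_norm_powR p (f := f \+ g)%R); exact: measurable_funD.
- apply: measurable_funeM.
  by apply: emeasurable_funD => //; exact: measurable_norm_powR.
- by move=> x _; rewrite lee_fin powR_normD ?ltW.
Qed.

Lemma modular_triangle f g h : measurable_fun setT f -> measurable_fun setT g ->
  measurable_fun setT h ->
  modular (f \- h)%R <= (2 `^ p)%:E * (modular (f \- g)%R + modular (g \- h)%R).
Proof.
move=> mf mg mh.
rewrite (_ : (f \- h)%R = ((f \- g) \+ (g \- h))%R); last first.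
  by apply/funext => x /=; rewrite addrA subrK.
by apply: modularD; exact: measurable_funB.
Qed.

Lemma modular_split f g : measurable_fun setT f -> measurable_fun setT g ->
  modular f <= (2 `^ p)%:E * (modular (f \- g)%R + modular g).
Proof.
move=> mf mg.
rewrite {1}(_ : f = ((f \- g) \+ g)%R); last first.
  by apply/funext => x /=; rewrite subrK.
by apply: modularD => //; exact: measurable_funB.
Qed.

Lemma modular_triangle_le f g h (a b : R) : measurable_fun setT f ->
  measurable_fun setT g -> measurable_fun setT h ->
  modular (f \- g)%R <= a%:E -> modular (g \- h)%R <= b%:E ->
  modular (f \- h)%R <= (2 `^ p * (a + b))%:E.
Proof.
move=> mf mg mh fg gh; apply: (le_trans (modular_triangle mf mg mh)).
rewrite EFinM EFinD; apply: lee_wpmul2l; first by rewrite lee_fin powR_ge0.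
exact: leeD fg gh.
Qed.

Lemma modular_split_le f g (a b : R) : measurable_fun setT f ->
  measurable_fun setT g ->
  modular (f \- g)%R <= a%:E -> modular g <= b%:E ->
  modular f <= (2 `^ p * (a + b))%:E.
Proof.
move=> mf mg fg gb; apply: (le_trans (modular_split mf mg)).
rewrite EFinM EFinD; apply: lee_wpmul2l; first by rewrite lee_fin powR_ge0.
exact: leeD fg gb.
Qed.

Lemma modularD_lty f g : measurable_fun setT f -> measurable_fun setT g ->
  modular f < +oo -> modular g < +oo -> modular (f \+ g)%R < +oo.
Proof.
move=> mf mg fy gy; apply: (le_lt_trans (modularD mf mg)).
apply: lte_mul_pinfty; [by rewrite lee_fin powR_ge0|by []|].
exact: (lte_add_pinfty fy gy).
Qed.

(** Finiteness is all that is needed of a finite sum, so the constants 2^p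
    that n applications of the quasi-triangle inequality produce are not
    tracked. *)
Lemma modular_sum_lty (n : nat) (h : 'I_n -> T -> R) :
  (forall i, measurable_fun setT (h i)) -> (forall i, modular (h i) < +oo) ->
  modular (fun x => \sum_i h i x)%R < +oo.
Proof.
move=> mh hy; elim: n h mh hy => [|n IH] h mh hy.
  rewrite (_ : (fun x => _) = cst 0%R) ?modular0//.
  by apply/funext => x; rewrite big_ord0.
rewrite (_ : (fun x => _) = h ord0 \+ (fun x => \sum_i h (lift ord0 i) x))%R.
  apply: modularD_lty => //; first exact: measurable_sum.
  by apply: IH.
by apply/funext => x; rewrite big_ord_recl.
Qed.

End modularD.

(** * Completeness of L^p *)

Lemma fast_increments_cvg (R : realType) (u : R^nat) (M : R) :
  (forall k, `|u k.+1 - u k| <= M * 2^-1 ^+ k) -> cvgn u.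
Proof.
move=> uM.
have M0 : 0 <= M by have := uM 0%N; rewrite expr0 mulr1; apply: le_trans.
have -> : u = (fun n => u 0%N + series (telescope u) n).
  by apply/funext => n; rewrite -eq_sum_telescope.
apply: is_cvgD; first exact: is_cvg_cst.
apply: normed_cvg.
apply: (@series_le_cvg _ _ (geometric M 2^-1)) => //.
- by move=> n /=.
- by move=> n; rewrite /= mulr_ge0// exprn_ge0.
by apply: is_cvg_geometric_series; rewrite ger0_norm ?invf_lt1 ?ltr1n.
Qed.

Lemma continuous_norm_powR (R : realType) (p : R) : 0 < p ->
  continuous (fun t : R => `|t| `^ p).
Proof.
move=> p0 t; have [->|t0] := eqVneq t 0.
  apply/cvgrPdist_lt => e e0.
  rewrite normr0 powR0 ?gt_eqF//; near=> s.
  rewrite sub0r normrN ger0_norm ?powR_ge0//.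
  rewrite -[e](@powRr1 R) ?(ltW e0)// -(mulVf (lt0r_neq0 p0)) powRrM.
  rewrite gt0_ltr_powR ?nnegrE ?powR_ge0//.
  near: s; apply/nbhs_ballP; exists (e `^ p^-1) => /=; first by rewrite powR_gt0.
  by move=> s; rewrite /ball /= sub0r normrN.
apply: (@continuous_comp _ _ _ (fun s : R => `|s|) (fun s => powR s p)); first exact: norm_continuous.
apply: differentiable_continuous; apply/derivable1_diffP; apply: derivable_powR.
by rewrite in_itv /= andbT normr_gt0.
Unshelve. all: by end_near. Qed.

Section fast_cauchy.
Context d (T : measurableType d) (R : realType).
Variables (nu : {measure set T -> \bar R}) (p : R).
Hypothesis p_gt0 : 0 < p.
Local Open Scope ereal_scope.
Local Notation modular := (modular nu p).

(** The error allowed at step k of a fast Cauchy sequence. An increment of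
    modular fast_rate k, rescaled by 2^k, has modular at most 1/2^(k+1): these
    are summable, which forces the increments to be O(2^-k) almost
    everywhere. *)
Definition fast_rate (k : nat) : R := ((2^-1 ^+ k) `^ p / (2 ^ k.+1)%:R)%R.

Lemma fast_rate_gt0 k : (0 < fast_rate k)%R.
Proof. by rewrite divr_gt0 ?powR_gt0 ?exprn_gt0// ltr0n expn_gt0. Qed.

Lemma fast_rate_small (e : R) : (0 < e)%R -> exists k, (fast_rate k < e)%R.
Proof.
move=> e0.
have [k ke] : exists k, (2^-1 ^+ k < e)%R.
  have /cvgrPdist_lt /(_ _ e0) : (@GRing.exp R 2^-1) @ \oo --> (0 : R)%R.
    by apply: cvg_expr; rewrite ger0_norm ?invf_lt1 ?ltr1n.
  move=> [k _ /(_ k (leqnn k))] /=.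
  by rewrite sub0r normrN ger0_norm ?exprn_ge0//; exists k.
exists k; apply: le_lt_trans ke; rewrite /fast_rate natrX -exprVn.
rewrite -[leRHS]mul1r ler_pM ?powR_ge0 ?exprn_ge0//; last first.
  by rewrite exprS ler_piMl ?exprn_ge0// invf_le1// ler1n.
have p1 : (1 = 1 `^ p :> R)%R by rewrite powR1.
rewrite [leRHS]p1 ge0_ler_powR ?nnegrE ?exprn_ge0 ?(ltW p_gt0)//.
by rewrite exprn_ile1// invf_le1// ler1n.
Qed.

(** The sum S of the |2^k (f_(k+1) - f_k)|^p has integral at most 1, hence is
    finite off a null set, and |f_(k+1) - f_k| <= S^(1/p) 2^-k wherever it is
    finite. No triangle inequality for the norm is involved, so the argument
    works for p < 1 as well. *)
Lemma fast_cauchy_ae_cvg (f_ : (T -> R)^nat) :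
  (forall n, measurable_fun setT (f_ n)) ->
  (forall k, modular (f_ k.+1 \- f_ k)%R <= (fast_rate k)%:E) ->
  exists2 D, measurable D & (forall x, D x -> cvgn (f_ ^~ x)) /\ nu (~` D) = 0.
Proof.
move=> mf fe.
pose a k x := (((2 ^+ k) * (f_ k.+1 x - f_ k x))%R).
pose b k x : \bar R := (`|a k x| `^ p)%:E.
have ma k : measurable_fun setT (a k).
  by apply: measurable_funM => //; exact: measurable_funB.
have mb k : measurable_fun setT (b k) by exact: measurable_norm_powR.
have b0 k x : 0 <= b k x by rewrite lee_fin powR_ge0.
pose S x := \sum_(0 <= k <oo) b k x.
have mS : measurable_fun setT S by exact: ge0_emeasurable_sum.
have S0 x : 0 <= S x by exact: nneseries_ge0.
have Sy : \int[nu]_x S x <= 1.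
  rewrite /S integral_nneseries//.
  apply: (@le_trans _ _ (\sum_(0 <= k <oo) (1 / (2 ^ k.+1)%:R)%:E)); last first.
    exact: epsilon_trick0.
  apply: lee_nneseries => k _; first by move=> _; exact: integral_ge0.
  rewrite (_ : \int[nu]_x _ = modular (a k))// modularZ//; last first.
    exact: measurable_funB.
  apply: (@le_trans _ _ ((`|2 ^+ k|%R `^ p)%:E * (fast_rate k)%:E)).
    by rewrite lee_pmul2l ?lte_fin ?powR_gt0 ?normr_gt0 ?expf_neq0// fe.
  rewrite -EFinM lee_fin /fast_rate mulrA ger0_norm ?exprn_ge0// -powRM ?exprn_ge0//.
  by rewrite -exprMn mulfV// expr1n powR1.
have iS : nu.-integrable setT S.
  apply/integrableP; split => //.
  under eq_integral do rewrite gee0_abs//.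
  by rewrite (le_lt_trans Sy)// ltry.
exists (S @^-1` [set x | x \is a fin_num]).
  by rewrite -[X in measurable X]setTI; exact: emeasurable_fin_num.
split.
  move=> x /= Sx.
  have Sxe : S x = (fine (S x))%:E by rewrite fineK.
  apply: (@fast_increments_cvg _ _ (fine (S x) `^ p^-1)) => k.
  have : b k x <= (fine (S x))%:E.
    rewrite -Sxe /S (@nneseriesD1 _ _ k)//.
    by rewrite leeDl// nneseries_ge0.
  rewrite lee_fin => bS.
  have p0' : (p != 0)%R by rewrite gt_eqF.
  have aS : (`|a k x| <= fine (S x) `^ p^-1)%R.
    rewrite -[leLHS](@powRr1 R)// -(mulfV p0') powRrM.
    by rewrite ge0_ler_powR ?nnegrE ?invr_ge0 ?powR_ge0 ?(ltW p_gt0) ?fine_ge0.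
  rewrite exprVn ler_pdivlMr ?exprn_gt0// mulrC.
  by move: aS; rewrite /a normrM ger0_norm// exprn_ge0.
have [N [mN N0 SN]] := integrable_ae measurableT iS.
apply/eqP; rewrite eq_le measure_ge0 andbT -N0; apply: le_measure => //.
- rewrite inE; apply: measurableC.
  by rewrite -[X in measurable X]setTI; exact: emeasurable_fin_num.
- by rewrite inE.
by move=> x /= Sx; apply: SN => /= /(_ I).
Qed.

(** Fatou applied to the |f_n - f_m|^p as m tends to infinity: the bound
    passes to the pointwise limit without loss. *)
Lemma fast_cauchy_modular_cvg (f_ : (T -> R)^nat) :
  (forall n, measurable_fun setT (f_ n)) ->
  (forall k m n, (k <= m)%N -> (k <= n)%N ->
    modular (f_ m \- f_ n)%R <= (fast_rate k)%:E) ->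
  exists2 g, measurable_fun setT g &
    forall n, modular (f_ n \- g)%R <= (fast_rate n)%:E.
Proof.
move=> mf fe.
have [D mD [Dc D0]] := fast_cauchy_ae_cvg mf (fun k => fe k _ _ (leqnSn k) (leqnn k)).
(* setting the functions to 0 off the set of convergence makes them converge
   everywhere, to a measurable limit *)
pose F n x := (f_ n x * \1_D x)%R.
have mF n : measurable_fun setT (F n) by exact: measurable_funM.
have Fc x : F ^~ x @ \oo --> limn (F ^~ x).
  have [xD|xD] := pselect (D x).
    have -> : F ^~ x = f_ ^~ x.
      by apply/funext => n; rewrite /F indicE mem_set// mulr1.
    exact: Dc.
  have -> : F ^~ x = cst 0%R.
    by apply/funext => n; rewrite /F indicE memNset// mulr0.
  exact: is_cvg_cst.
have FE n : F n = f_ n %[ae nu].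
  exists (~` D); split => //; first exact: measurableC.
  move=> x /= h xD; apply: h => _.
  by rewrite /F indicE mem_set// mulr1.
have mg : measurable_fun setT (fun x => limn (F ^~ x)).
  by apply: (measurable_fun_cvg mF) => x _; exact: Fc.
exists (fun x => limn (F ^~ x)) => // n.
have -> : modular (f_ n \- (fun x => limn (F ^~ x)))%R =
          modular (F n \- (fun x => limn (F ^~ x)))%R.
  apply: modular_ae; try exact: measurable_funB.
  by apply: filterS (FE n) => x /= h _; rewrite h.
pose G m x : \bar R := (`|F n x - F m x| `^ p)%:E.
have mG m : measurable_fun setT (G m).
  by apply: (measurable_norm_powR p (f := F n \- F m)%R); exact: measurable_funB.
have -> : modular (F n \- (fun x => limn (F ^~ x)))%R =
    \int[nu]_x limn_einf (G ^~ x).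
  apply: eq_integral => x _; symmetry.
  have : G ^~ x @ \oo --> (`|F n x - limn (F ^~ x)| `^ p)%:E.
    apply/cvg_EFin; first by near=> m.
    apply: (@cvg_comp _ _ _ (fun m => F n x - F m x)%R (fun t : R => `|t| `^ p)%R
      _ (nbhs (F n x - limn (F ^~ x))%R)).
      by apply: cvgB; [exact: cvg_cst|exact: Fc].
    exact: continuous_norm_powR.
  by move=> /cvg_limn_einf_sup [].
apply: (le_trans (fatou nu measurableT mG _)).
  by move=> m x _; rewrite lee_fin powR_ge0.
rewrite limn_einf_lim; apply: lime_le; first exact: is_cvg_einfs.
exists n => // m /= nm; rewrite /einfs.
apply: (@le_trans _ _ (\int[nu]_x G m x)).
  by apply: ereal_inf_lbound; exists m => /=.
have <- : modular (f_ n \- f_ m)%R = \int[nu]_x G m x.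
  apply: modular_ae; try exact: measurable_funB.
  by apply: filterS2 (FE n) (FE m) => x /= h h' _; rewrite h ?h'.
exact: fe.
Unshelve. all: by end_near. Qed.

End fast_cauchy.

(** * Precompact subsets of L^p *)

(** A segment is compact, and an ultrafilter converges to each of its cluster
    points. *)
Lemma ultra_bounded_cluster (R : realType) (I : Type) (F : set_system I)
    (a : I -> R) (M : R) : UltraFilter F -> F [set i | `|a i| <= M] ->
  exists l, forall e, 0 < e -> F [set i | `|a i - l| < e].
Proof.
move=> FU FM.
have FF : ProperFilter F by exact: ultra_proper.
have : (a @ F) `[- M, M]%classic.
  rewrite /fmap /nbhs /=.
  suff -> : a @^-1` `[- M, M]%classic = [set i | `|a i| <= M] by [].
  by apply/seteqP; split => i /=; rewrite in_itv /= -ler_norml.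
move=> /segment_compact[l [_ cl]].
exists l => e e0.
have [//|FC] := in_ultra_setVsetC [set i | `|a i - l| < e] FU.
have lV : nbhs l (ball l e) by exact: nbhsx_ballx.
have aC : (a @ F) (~` ball l e).
  rewrite /fmap /nbhs /=.
  suff -> : a @^-1` (~` ball l e) = ~` [set i | `|a i - l| < e] by [].
  by apply/seteqP; split => i /=; rewrite /ball /= distrC.
by have [y []] := cl _ _ aC lV.
Qed.

Section Lp_topology.
Context d (T : measurableType d) (R : realType).
Variables (nu : {measure set T -> \bar R}) (p : R) (p_gt0 : 0 < p).
Local Open Scope ereal_scope.
Local Notation modular := (modular nu p).
Local Notation Lp := (Lp nu p_gt0).

Lemma measurable_Lp (f : Lp) : measurable_fun setT (f : T -> R).
Proof. by rewrite /Lp_fun /aqEqMfun_to_fun; exact: (@measurable_funPT _ _ _ _ (repr (sval f))). Qed.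

Lemma modular_Lp_lty (f : Lp) : modular f < +oo.
Proof. by apply/(Lnorm_lty nu p_gt0); exact: (svalP f). Qed.

(** A member of Lp is a class of functions; this is how a limit built as a
    function comes back to Lp. *)
Lemma Lp_of_fun (f : T -> R) : measurable_fun setT f -> modular f < +oo ->
  exists F : Lp, (F : T -> R) = f %[ae nu].
Proof.
move=> mf fy.
pose f' : {mfun T >-> measurableTypeR R} :=
  @mfun_Sub _ _ T (measurableTypeR R) f (mem_set mf).
pose F' : {mfun_ nu, T >-> measurableTypeR R} := (\pi_({mfun_ nu, T >-> measurableTypeR R}) f')%qT.
have FE : (F' : T -> R) = f %[ae nu].
  have /eqmodP/asboolP : (repr F' = f' %[mod {mfun_ nu, T >-> measurableTypeR R}])%qT.
    by rewrite reprK.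
  exact.
have Fy : finite_norm nu p%:E F'.
  apply/(Lnorm_lty nu p_gt0); rewrite (modular_ae p _ mf FE)//.
  exact: (@measurable_funPT _ _ _ _ (repr F')).
by exists (exist _ F' Fy).
Qed.

Lemma Lp_nbhsP (f : Lp) (A : set Lp) :
  nbhs f A <->
  exists2 e : R, (0 < e)%R & forall g : Lp, modular (f \- g)%R < e%:E -> A g.
Proof.
split.
  move=> /nbhsP[B [e e0 eB] BA].
  exists (e `^ p)%R; first exact: powR_gt0.
  move=> g fg; apply: BA; apply/xsectionP; apply: eB => /=.
  by apply/(Lnorm_lt nu p_gt0) => //; exact: ltW.
move=> [e e0 eA]; apply/nbhsP.
exists [set fg : Lp * Lp | modular (fg.1 \- fg.2)%R < e%:E].
  exists (e `^ p^-1)%R; first exact: powR_gt0.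
  move=> fg /= /(Lnorm_lt nu p_gt0).
  rewrite -powRrM mulVf ?gt_eqF// powRr1 ?(ltW e0)//.
  by apply; exact: powR_ge0.
by move=> g /xsectionP /= /eA.
Qed.

(** A Cauchy filter is followed by a fast Cauchy sequence: f_n is picked in
    the intersection of the first n small sets. The limit of the sequence is
    then a limit of the filter. *)
Lemma Lp_complete (F : set_system Lp) : ProperFilter F ->
  (forall e : R, (0 < e)%R -> exists2 A, F A &
    forall f g, A f -> A g -> modular (f \- g)%R <= e%:E) ->
  exists f : Lp, F --> f.
Proof.
move=> FF FC.
have /choice[A HA] k : exists A : set Lp, F A /\
    forall f g, A f -> A g -> modular (f \- g)%R <= (fast_rate p k)%:E.
  by have [A FA AA] := FC _ (fast_rate_gt0 p k); exists A.
have FI n : F (\bigcap_(k in `I_n.+1) A k).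
  elim: n => [|n IH].
    by rewrite bigcap_mkord big_ord_recr big_ord0 /= setTI; exact: (HA 0%N).1.
  rewrite bigcap_mkord big_ord_recr /= -bigcap_mkord.
  by apply: filterI => //; exact: (HA n.+1).1.
have /choice[f_ Hf] n : exists f, (\bigcap_(k in `I_n.+1) A k) f.
  exact: filter_ex (FI n).
have fA k n : (k <= n)%N -> A k (f_ n) by move=> kn; apply: Hf; rewrite /= ltnS.
have [g mg fg] : exists2 g, measurable_fun setT g &
    forall n, modular (f_ n \- g)%R <= (fast_rate p n)%:E.
  apply: fast_cauchy_modular_cvg => //; first by move=> n; exact: measurable_Lp.
  by move=> k m n km kn; apply: (HA k).2; exact: fA.
have gy : modular g < +oo.
  pose m0 : R := fine (modular (f_ 0%N)).
  have f0y : modular (f_ 0%N) <= m0%:E.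
    by rewrite fineK// ge0_fin_numE ?modular_ge0// modular_Lp_lty.
  have gf0 := fg 0%N; rewrite modularBC in gf0.
  apply: le_lt_trans (ltry (2 `^ p * (fast_rate p 0 + m0))%R).
  exact: (modular_split_le p_gt0 mg (measurable_Lp (f_ 0%N)) gf0 f0y).
have [G GE] := Lp_of_fun mg gy.
exists G => B /Lp_nbhsP[e e0 eB].
(* two errors c through the quasi-triangle inequality cost 2^p (c + c) = e/2,
   which leaves room for the strict inequality *)
pose c : R := (e / (2 `^ p * 4))%R.
have c0 : (0 < c)%R by rewrite divr_gt0// mulr_gt0// powR_gt0.
have [n nc] := fast_rate_small p_gt0 c0.
apply: filterS (HA n).1 => h Ah; apply: eB.
have h1 : modular (G \- f_ n)%R <= c%:E.
  have -> : modular (G \- f_ n)%R = modular (g \- f_ n)%R.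
    apply: modular_ae; first exact: measurable_funB (measurable_Lp _) (measurable_Lp _).
      exact: measurable_funB mg (measurable_Lp _).
    by apply: filterS GE => x /= E xT; rewrite E.
  rewrite modularBC; apply: (le_trans (fg n)).
  by rewrite lee_fin ltW.
have h2 : modular (f_ n \- h)%R <= c%:E.
  by apply: (le_trans ((HA n).2 _ _ (fA _ _ (leqnn n)) Ah)); rewrite lee_fin ltW.
apply: (le_lt_trans (modular_triangle_le p_gt0 (measurable_Lp G)
  (measurable_Lp (f_ n)) (measurable_Lp h) h1 h2)).
have k0 : (2 `^ p != 0 :> R)%R by rewrite gt_eqF ?powR_gt0.
rewrite lte_fin (_ : _ * _ = e / 2)%R; first by lra.
by rewrite /c; field.
Qed.

(** Total boundedness in a form suited to step functions: up to an error e,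
    the members of U are combinations of finitely many fixed functions with
    coefficients in a fixed segment. *)
Definition finitely_approximable (U : set Lp) := forall e : R, (0 < e)%R ->
  exists n (h : 'I_n -> T -> R) (M : R),
    (forall i, measurable_fun setT (h i) /\ modular (h i) < +oo) /\
    forall f, U f -> exists c : 'I_n -> R, (forall i, `|c i| <= M)%R /\
      modular (f \- (fun x => \sum_i c i * h i x)%R)%R <= e%:E.

Lemma finitely_approximable_closure U :
  finitely_approximable U -> finitely_approximable (closure U).
Proof.
move=> UA e e0.
pose c : R := (e / (2 `^ p * 2))%R.
have k0 : (2 `^ p != 0 :> R)%R by rewrite gt_eqF ?powR_gt0.
have c0 : (0 < c)%R by rewrite divr_gt0// mulr_gt0// powR_gt0.
have [n [h [M [mh hU]]]] := UA _ c0.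
exists n, h, M; split => // f Uf.
have [g [Ug fg]] : U `&` [set g | modular (f \- g)%R < c%:E] !=set0.
  by apply: Uf; apply/Lp_nbhsP; exists c.
have [a [aM ga]] := hU _ Ug; exists a; split => //.
have ms : measurable_fun setT (fun x => \sum_i a i * h i x)%R.
  by apply: measurable_sum => i; apply: measurable_funM => //; exact: (mh i).1.
apply: (le_trans (modular_triangle_le p_gt0 (measurable_Lp f) (measurable_Lp g) ms
  (ltW fg) ga)).
by rewrite lee_fin (_ : _ * _ = e)%R// /c; field.
Qed.

(** Along an ultrafilter each of the n bounded coefficients converges, so two
    members of a suitable set of the ultrafilter have nearly the same
    coefficients, hence nearly the same approximations. *)
Lemma finitely_approximable_ultra_cauchy (U : set Lp) (F : set_system Lp) :
  UltraFilter F -> F U -> finitely_approximable U ->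
  forall e : R, (0 < e)%R -> exists2 A, F A &
    forall f g, A f -> A g -> modular (f \- g)%R <= e%:E.
Proof.
move=> FU FUU UA e e0.
have FF : ProperFilter F by exact: ultra_proper.
have k0 : (0 < 2 `^ p :> R)%R by rewrite powR_gt0.
have kN0 : (2 `^ p != 0 :> R)%R by rewrite gt_eqF.
pose c : R := (e / (2 `^ p * (2 `^ p) * 4))%R.
have c0 : (0 < c)%R by rewrite divr_gt0// !mulr_gt0.
have [n [h [M [mh hU]]]] := UA _ c0.
have mhi i : measurable_fun setT (h i) := (mh i).1.
have ms (a : 'I_n -> R) : measurable_fun setT (fun x => \sum_i a i * h i x)%R.
  by apply: measurable_sum => i; exact: measurable_funM.
have /choice[a Ha] f : exists a : 'I_n -> R, U f -> (forall i, `|a i| <= M)%R /\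
      modular (f \- (fun x => \sum_i a i * h i x)%R)%R <= c%:E.
  have [Uf|nUf] := pselect (U f); last by exists (fun=> 0%R).
  by have [a Ha] := hU _ Uf; exists a.
have /choice[l Hl] i : exists l, forall e, (0 < e)%R -> F [set f | `|a f i - l| < e]%R.
  apply: (@ultra_bounded_cluster _ _ _ (fun f => a f i) M) => //.
  by apply: filterS FUU => f /Ha[/(_ i)].
(* if all coefficients of two combinations differ by at most dl, the
   combinations differ by at most dl H pointwise *)
pose H x := (\sum_i `|h i x|)%R.
have mH : measurable_fun setT H.
  by apply: measurable_sum => i; exact: measurableT_comp.
have Hy : modular H < +oo.
  apply: (modular_sum_lty p_gt0) => i; first exact: measurableT_comp.
  rewrite (_ : modular _ = modular (h i)); first exact: (mh i).2.
  by apply: eq_integral => x _; rewrite normr_id.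
pose m : R := fine (modular H).
have m0 : (0 <= m)%R by rewrite fine_ge0 ?modular_ge0.
(* dl^p m <= c; the term m + 1 guards against m = 0 *)
pose dl : R := ((c / (m + 1)) `^ p^-1)%R.
have cm0 : (0 < c / (m + 1))%R by rewrite divr_gt0// ltr_wpDl.
have dl0 : (0 < dl)%R by rewrite powR_gt0.
exists (U `&` [set f | forall i, `|a f i - l i| < dl / 2]%R).
  apply: filterI => //; apply: filter_forall => i.
  by apply: Hl; rewrite divr_gt0.
move=> f g [Uf af] [Ug ag].
pose s (u : Lp) x := (\sum_i a u i * h i x)%R.
have h1 : modular (f \- s f)%R <= c%:E by exact: (Ha f Uf).2.
have h2 : modular (s g \- g)%R <= c%:E by rewrite modularBC; exact: (Ha g Ug).2.
have h3 : modular (s f \- s g)%R <= c%:E.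
  apply: (@le_trans _ _ (modular (fun x => dl * H x)%R)).
    apply: modular_le => //.
    - by apply: measurable_funB; exact: ms.
    - by apply: measurable_funM => //; exact: measurable_cst.
    - move=> x; rewrite /s /= -sumrB; apply: (le_trans (ler_norm_sum _ _ _)).
      rewrite normrM (ger0_norm (ltW dl0)) ger0_norm ?sumr_ge0//.
      rewrite mulr_sumr ler_sum// => i _.
      rewrite -mulrBl normrM ler_wpM2r//.
      have := af i; have := ag i.
      rewrite [X in (X < _)%R -> _]distrC => gi fi.
      rewrite (_ : a f i - a g i = (a f i - l i) + (l i - a g i))%R; last by ring.
      by apply: (le_trans (ler_normD _ _)); lra.
  rewrite modularZ// gtr0_norm// /dl -powRrM mulVf ?gt_eqF// powRr1 ?(ltW cm0)//.
  rewrite -(@fineK _ (modular H)) ?ge0_fin_numE ?modular_ge0// -/m -EFinM lee_fin.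
  rewrite -mulrA ler_piMr ?(ltW c0)// mulrC ler_pdivrMr ?ltr_wpDl// mul1r.
  by rewrite lerDl.
have h4 := modular_triangle_le p_gt0 (ms (a f)) (ms (a g)) (measurable_Lp g) h3 h2.
apply: (le_trans (modular_triangle_le p_gt0 (measurable_Lp f) (ms (a f))
  (measurable_Lp g) h1 h4)).
rewrite lee_fin.
have k1 : (1 <= 2 `^ p :> R)%R.
  have p1 : (1 = 1 `^ p :> R)%R by rewrite powR1.
  by rewrite [leLHS]p1 ge0_ler_powR ?nnegrE ?(ltW p_gt0)// ler1n.
apply: (@le_trans _ _ (2 `^ p * (2 `^ p * c + 2 `^ p * (c + c))))%R.
  by rewrite ler_wpM2l ?(ltW k0)// lerD2r ler_peMl// ltW.
rewrite (_ : _ * _ = 3 / 4 * e)%R; last by rewrite /c; field.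
by lra.
Qed.

Lemma finitely_approximable_precompact U :
  finitely_approximable U -> precompact U.
Proof.
move=> UA; exists (closure U); first by move=> f; exact: subset_closure.
split; last exact: closed_closure.
rewrite compact_ultra => F FU FUU.
have FF : ProperFilter F by exact: ultra_proper.
have [f Ff] : exists f : Lp, F --> f.
  apply: Lp_complete => //.
  apply: (finitely_approximable_ultra_cauchy FU FUU).
  exact: finitely_approximable_closure.
exists f; split => //; apply: closed_closure => B fB.
by apply: (@filter_ex _ F); apply: filterI => //; exact: Ff.
Qed.

End Lp_topology.

(** * Balls of a doubling space *)

Section metric_balls.
Context (R : realType) (S : completeMetricType R).
Implicit Types (x y z : S) (r : R).

Lemma ball_mdist x r y : ball x r y = (mdist x y < r) :> Prop.
Proof. by rewrite -metricType_numDomainType.ball_mdistE. Qed.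

Lemma open_metric_ball x r : open (ball x r).
Proof.
rewrite openE => y; rewrite ball_mdist => xy.
apply/nbhs_ballP; exists (r - mdist x y) => /=; first by rewrite subr_gt0.
move=> z; rewrite !ball_mdist => yz.
by rewrite (le_lt_trans (metric_triangle _ y _))// addrC -ltrBrDr.
Qed.

Lemma measurable_open_set (U : set S) : open U -> measurable (U : set (borel S)).
Proof. exact: sub_sigma_algebra. Qed.

Lemma measurable_metric_ball x r : measurable (ball x r : set (borel S)).
Proof. by apply: measurable_open_set; exact: open_metric_ball. Qed.

Lemma ball_empty x r : r <= 0 -> ball x r = set0.
Proof.
move=> r0; apply/seteqP; split => // y; rewrite ball_mdist => xy.
by move: (lt_le_trans xy r0); rewrite ltNge mdist_ge0.
Qed.

Lemma subset_ball x y r s : mdist x y + r <= s -> ball y r `<=` ball x s.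
Proof.
move=> h z; rewrite !ball_mdist => yz.
by rewrite (le_lt_trans (metric_triangle _ y _))// (lt_le_trans _ h)// ltrD2l.
Qed.

Lemma bigcup_ball x : \bigcup_n ball x n%:R = [set: S].
Proof.
apply/seteqP; split => // y _; exists (Num.trunc (mdist x y)).+1 => //.
by rewrite ball_mdist truncnS_gt.
Qed.

Lemma ball_sigma_finite (m : {measure set (borel S) -> \bar R}) :
  (forall x r, (m (ball x r) < +oo)%E) -> sigma_finite setT m.
Proof.
move=> my; exists (fun n => ball (point : S) n%:R); first by rewrite bigcup_ball.
by move=> n; split; [exact: measurable_metric_ball|exact: my].
Qed.

End metric_balls.

(** Bundles finiteness on balls as sigma-finiteness, the form in which Tonelli's
    theorem takes a measure; the set function is unchanged, so integrals
    against the two measures agree by conversion. *)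
Definition sigma_finite_on_balls (R : realType) (S : completeMetricType R)
    (m : {measure set (borel S) -> \bar R})
    (my : forall (x : S) r, (m (ball x r) < +oo)%E) :
    {sigma_finite_measure set (borel S) -> \bar R} :=
  HB.pack (Measure.sort m) (Measure.class m)
    (isSFinite.Build _ _ _ (Measure.sort m)
       (sfinite_measure_sigma_finite (ball_sigma_finite my)))
    (isSigmaFinite.Build _ _ _ (Measure.sort m) (ball_sigma_finite my)).

(** Fixing the doubling constant lets later constants be explicit functions of
    it. *)
Definition doubling_with (R : realType) (S : completeMetricType R)
    (mu : {measure set (borel S) -> \bar R}) (C : R) :=
  forall (x : S) (r : R), 0 < r ->
  [/\ (0 < mu (ball x (2 * r)%R))%E,
      (mu (ball x (2 * r)%R) <= C%:E * mu (ball x r))%E &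
      (mu (ball x r) < +oo)%E].

Section doubling_geometry.
Context (R : realType) (S : completeMetricType R).
Variable mu : {measure set (borel S) -> \bar R}.
Variable C : R.
Hypothesis mu_doubling : doubling_with mu C.
Implicit Types (x y z : S) (r : R).
Local Open Scope ereal_scope.

Lemma mu_ball_gt0 x r : (0 < r)%R -> 0 < mu (ball x r).
Proof.
move=> r0; have r20 : (0 < r / 2)%R by rewrite divr_gt0.
by have [+ _ _] := mu_doubling x r20; rewrite mulrC divfK.
Qed.

Lemma mu_ball_lty x r : mu (ball x r) < +oo.
Proof.
have [r0|r0] := ltP 0%R r; first by have [] := mu_doubling x r0.
by rewrite (ball_empty _ r0) measure0 ltry.
Qed.

Lemma mu_ball_fin x r : mu (ball x r) \is a fin_num.
Proof. by rewrite ge0_fin_numE// mu_ball_lty. Qed.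

Lemma doubling_const_gt0 : (0 < C)%R.
Proof.
have [h1 h2 _] := mu_doubling point ltr01.
have := lt_le_trans h1 h2; rewrite -(fineK (mu_ball_fin _ 1)) -EFinM lte_fin.
by rewrite pmulr_lgt0// fine_gt0// mu_ball_lty mu_ball_gt0.
Qed.

Lemma doubling_iter x r k : (0 < r)%R ->
  mu (ball x (2 ^+ k * r)%R) <= (C ^+ k)%:E * mu (ball x r).
Proof.
move=> r0; elim: k => [|k IH]; first by rewrite !expr0 mul1r mul1e.
have kr : (0 < 2 ^+ k * r)%R by rewrite mulr_gt0// exprn_gt0.
have [_ + _] := mu_doubling x kr; rewrite mulrA -exprS => /le_trans; apply.
rewrite exprS EFinM -muleA lee_pmul2l//.
by rewrite lte_fin doubling_const_gt0.
Qed.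

(** Otherwise some sequence in the ball is r-separated. The balls of radius r/2
    around its points are disjoint, lie in B(x, A + r), and by doubling all
    have measure at least a fixed fraction of that of B(x, A + r): only
    finitely many fit. *)
Lemma ball_finite_net x A r : (0 < A)%R -> (0 < r)%R -> exists zs : seq S,
  forall y, ball x A y -> exists2 z, z \in zs & ball z r y.
Proof.
move=> A0 r0; apply: contrapT => noNet.
have /choice[next Hnext] (zs : seq S) : exists y,
    ball x A y /\ forall z, z \in zs -> ~ ball z r y.
  apply: contrapT => H; apply: noNet; exists zs => y xy.
  apply: contrapT => H'; apply: H; exists y; split => // z zs_ zy.
  by apply: H'; exists z.
pose pre := fix pre n := if n is n'.+1 then next (pre n') :: pre n' else [::].
pose s n := next (pre n).
have s_pre i n : (i < n)%N -> s i \in pre n.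
  elim: n => // n IH; rewrite ltnS leq_eqVlt => /predU1P[->|/IH h] /=.
    by rewrite inE eqxx.
  by rewrite inE h orbT.
have sA n : (mdist x (s n) < A)%R by rewrite -ball_mdist; exact: (Hnext _).1.
have s_sep i n : (i < n)%N -> (r <= mdist (s i) (s n))%R.
  move=> /s_pre h; rewrite leNgt; apply/negP => H.
  by apply: ((Hnext (pre n)).2 _ h); rewrite ball_mdist.
pose B n := ball (s n) (r / 2)%R.
have mB n : measurable (B n : set (borel S)) by exact: measurable_metric_ball.
have tB : trivIset [set: nat] B.
  suff H i j y : (i < j)%N -> B i y -> B j y -> False.
    move=> i j _ _ [y [iy jy]]; have [ | |//] := ltngtP i j.
    - by move=> /H h; case: (h y iy jy).
    - by move=> /H h; case: (h y jy iy).
  rewrite /B /= !ball_mdist => /s_sep + iy jy.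
  have := metric_triangle (s i) y (s j); rewrite (metric_sym y) => + ?.
  by lra.
(* a ball of radius 2A + r around any s n contains B(x, A + r) *)
have [k kP] : exists k, (2 * A + r <= 2 ^+ k * (r / 2))%R.
  exists (Num.trunc ((2 * A + r) / (r / 2))).+1.
  rewrite -ler_pdivrMr ?divr_gt0//; apply: ltW.
  apply: (lt_trans (truncnS_gt _)).
  by rewrite -natrX ltr_nat ltn_expl.
pose m := fine (mu (ball x (A + r)%R)).
have mE : mu (ball x (A + r)%R) = m%:E by rewrite fineK ?mu_ball_fin.
have m0 : (0 < m)%R.
  by rewrite fine_gt0// mu_ball_gt0 ?addr_gt0//= mu_ball_lty.
have Ck0 : (0 < C ^+ k)%R by rewrite exprn_gt0// doubling_const_gt0.
have Bm n : (m / C ^+ k)%:E <= mu (B n).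
  rewrite EFinM muleC lee_pdivrMl//.
  apply: (le_trans _ (doubling_iter _ _ _)); last by rewrite divr_gt0.
  rewrite -mE; apply: le_measure; rewrite ?inE; try exact: measurable_metric_ball.
  apply: subset_ball; apply: le_trans kP; have := sA n.
  by rewrite metric_sym; lra.
pose N := (Num.trunc (C ^+ k)).+1.
have : mu (\big[setU/set0]_(i < N) B i) <= m%:E.
  rewrite -mE; apply: le_measure; rewrite ?inE.
  - exact: bigsetU_measurable.
  - exact: measurable_metric_ball.
  - rewrite -bigcup_mkord => y [i _]; apply: subset_ball.
    by have := sA i; lra.
rewrite measure_bigsetU// leNgt => /negP; apply.
apply: (@lt_le_trans _ _ (\sum_(i < N) (m / C ^+ k)%:E)); last first.
  by apply: lee_sum => i _; exact: Bm.
rewrite sumEFin lte_fin sumr_const card_ord -mulr_natl mulrCA ltr_pMr//.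
by rewrite ltr_pdivlMr// mul1r truncnS_gt.
Qed.

(** Nets of radius 1/(n+1) in B(point, n+1) for every n: together they make a
    countable dense set. *)
Lemma ball_net : exists net : nat -> seq S, forall n y, ball point n.+1%:R y ->
  exists2 z, z \in net n & ball z (n.+1%:R^-1)%R y.
Proof.
suff /choice[net netP] n : exists zs : seq S, forall y, ball point n.+1%:R y ->
    exists2 z, z \in zs & ball z (n.+1%:R^-1)%R y by exists net.
by apply: ball_finite_net; rewrite ?invr_gt0 ltr0n.
Qed.

(** The set is open, but an open set of S x S is in the product of the Borel
    sigma-algebras because S is separable: the nets exhibit the set as a
    countable union of products of balls. This is what makes Tonelli's theorem
    applicable to averages over moving balls. *)
Lemma measurable_near_pairs r :
  measurable [set xy : borel S * borel S | ball (xy.1 : S) r xy.2].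
Proof.
have [net netP] := ball_net.
pose e n : R := (n.+1%:R^-1)%R.
rewrite (_ : [set _ | _] = \bigcup_n \bigcup_(z in [set` net n])
  (ball z (e n) `*` ball z (r - e n)%R)); last first.
  apply/seteqP; split => -[x y] /=; last first.
    move=> [n _] [z _ [/=]]; rewrite !ball_mdist => zx zy.
    have := metric_triangle x z y; rewrite (metric_sym x z) => ?.
    by lra.
  rewrite ball_mdist => xy.
  (* a net point z within g of x satisfies d(z, y) < r - g *)
  pose g : R := ((r - mdist x y) / 2)%R.
  have g0 : (0 < g)%R by rewrite divr_gt0// subr_gt0.
  pose n := (maxn (Num.trunc (mdist point x)) (Num.trunc g^-1))%N.
  have xn : ball point n.+1%:R x.
    rewrite ball_mdist (lt_le_trans (truncnS_gt _))// ler_nat ltnS.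
    exact: leq_maxl.
  have eg : (e n < g)%R.
    rewrite /e invf_plt ?posrE ?ltr0n//.
    by rewrite (lt_le_trans (truncnS_gt _))// ler_nat ltnS leq_maxr.
  have [z zn zx] := netP _ _ xn.
  exists n => //; exists z => //; split => //=.
  move: zx; rewrite !ball_mdist -/(e n) => zx.
  by have := metric_triangle z x y; move: eg; rewrite /g => ? ?; lra.
apply: bigcup_measurable => n _; apply: fin_bigcup_measurable.
  exact: finite_seq.
by move=> z _; apply: measurableX; exact: measurable_metric_ball.
Qed.

Lemma measurable_ball_integral (m : {measure set (borel S) -> \bar R})
    (G : borel S * borel S -> \bar R) r :
  (forall (x : S) r, m (ball x r) < +oo) ->
  measurable_fun setT G -> (forall xy, 0 <= G xy) ->
  measurable_fun setT (fun x : borel S => \int[m]_(y in ball (x : S) r) G (x, y)).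
Proof.
move=> my mG G0.
pose m' := sigma_finite_on_balls my.
pose V : set (borel S * borel S) := [set xy | ball (xy.1 : S) r xy.2].
have mV : measurable V by exact: measurable_near_pairs.
pose H (z : borel S * borel S) : \bar R := G z * (\1_V z)%:E.
have mH : measurable_fun setT H.
  by apply: emeasurable_funM => //; apply/measurable_EFinP; exact: measurable_indic.
have H0 (z : borel S * borel S) : 0 <= H z by rewrite mule_ge0// lee_fin.
have := measurable_fun_fubini_tonelli_F (m2 := m') H mH H0.
apply: eq_measurable_fun => x _; rewrite /fubini_F.
rewrite [RHS]integral_mkcond; apply: eq_integral => y _.
rewrite /H patchE /= indicE.
have [xy|xy] := pselect (ball (x : S) r y).
  by rewrite !mem_set// mule1.
by rewrite !memNset// mule0.
Qed.

Lemma measurable_inv_ball (m : {measure set (borel S) -> \bar R}) r :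
  (forall (x : S) r, m (ball x r) < +oo) ->
  measurable_fun setT (fun x : borel S => (m (ball (x : S) r))^-1).
Proof.
move=> my.
have mb : measurable_fun setT (fun x : borel S => fine (m (ball (x : S) r))).
  apply: (measurableT_comp (fine_measurable measurableT)) => //.
  have := measurable_ball_integral r my (measurable_cst (1 : \bar R)) (fun=> lee01).
  apply: eq_measurable_fun => x _ /=.
  by rewrite integral_cst ?mul1e//; exact: measurable_metric_ball.
rewrite (_ : (fun x => _) = (fun x : borel S =>
    if fine (m (ball (x : S) r)) == 0%R then +oo
    else (fine (m (ball (x : S) r)) `^ (-1))%:E)).
  apply: measurable_fun_ifT => //.
    by apply: measurable_fun_eqr.
  apply/measurable_EFinP.
  by apply: (measurableT_comp (measurable_powR _)).
apply/funext => x; have mE : m (ball x r) \is a fin_num by rewrite ge0_fin_numE// my.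
rewrite -{1}(fineK mE) inver; case: ifPn => // _.
by rewrite powR_inv1// fine_ge0.
Qed.

End doubling_geometry.

(** * Mean oscillation *)

(** A function cannot exceed its mean everywhere. The slack e turns the
    negation into a strict bound between reals, which integrates to a
    contradiction. *)
Lemma exists_le_mean d (T : measurableType d) (R : realType)
    (nu : {measure set T -> \bar R}) (P : set T) (h : T -> \bar R) (e : R) :
  measurable P -> (0 < nu P < +oo)%E -> measurable_fun setT h ->
  (forall x, 0 <= h x)%E -> 0 < e ->
  exists2 x, P x & (nu P * h x <= \int[nu]_(x in P) h x + e%:E)%E.
Proof.
move=> mP /andP[P0 Py] mh h0 e0.
set I := (\int[nu]_(x in P) h x)%E.
have I0 : (0 <= I)%E by exact: integral_ge0.
have nuPE : nu P = (fine (nu P))%:E by rewrite fineK// ge0_fin_numE.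
have nuP0 : 0 < fine (nu P) by rewrite fine_gt0// P0.
have [Iy|Iy] := eqVneq I +oo%E.
  have [x Px] : P !=set0.
    by apply/set0P/eqP => P00; move: P0; rewrite P00 measure0 ltxx.
  by exists x => //; rewrite Iy addye// leey.
have IE : I = (fine I)%:E by rewrite fineK// ge0_fin_numE// ltey.
apply: contrapT => H.
pose b : R := fine I + e.
have Ib : (I + e%:E = b%:E)%E by rewrite /b EFinD -IE.
have {}H x : P x -> (b%:E <= nu P * h x)%E.
  by move=> Px; rewrite -Ib leNgt; apply/negP => /ltW ?; apply: H; exists x.
have : (\int[nu]_(x in P) b%:E <= \int[nu]_(x in P) (nu P * h x))%E.
  apply: ge0_le_integral => //.
  - by move=> x _; rewrite -Ib adde_ge0// lee_fin ltW.
  - by apply: measurable_funeM; exact: measurable_funTS.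
rewrite ge0_integralZl//; last exact: measurable_funTS.
rewrite integral_cst// -/I nuPE IE -!EFinM lee_fin leNgt => /negP; apply.
by rewrite mulrC ltr_pM2r// /b ltrDl.
Qed.

Lemma ge0_integral_affine d (T : measurableType d) (R : realType)
    (nu : {measure set T -> \bar R}) (P : set T) (k : R) (g : T -> \bar R)
    (a : \bar R) :
  measurable P -> measurable_fun P g -> (forall x, 0 <= g x)%E -> (0 <= a)%E ->
  0 <= k ->
  (\int[nu]_(x in P) (k%:E * (g x + a)) =
    k%:E * (\int[nu]_(x in P) g x + a * nu P))%E.
Proof.
move=> mP mg g0 a0 k0; rewrite ge0_integralZl//; first last.
- by move=> x _; rewrite adde_ge0.
- exact: emeasurable_funD.
by rewrite ge0_integralD// integral_cst.
Qed.

Section mean_oscillation.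
Context (R : realType) (S : completeMetricType R).
Variables mu nu : {measure set (borel S) -> \bar R}.
Variable C : R.
Hypothesis mu_doubling : doubling_with mu C.
Hypothesis nu_ball_lty : forall (x : S) (r : R), (nu (ball x r) < +oo)%E.
Variables p p0 : R.
Hypotheses (p_gt0 : 0 < p) (p0_gt1 : 1 < p0).
Implicit Types (x y z : S) (r : R) (f g : S -> R).
Local Open Scope ereal_scope.

Let p0_gt0 : (0 < p0)%R := lt_trans ltr01 p0_gt1.
Let q : R := (p / p0)%R.
Let q_gt0 : (0 < q)%R. Proof. exact: divr_gt0. Qed.

(** The inner average of condition (iii), before it is raised to the power p0
    and integrated. *)
Definition mean_osc r f x : \bar R :=
  average mu (ball x r) (fun y => (`|f x - f y| `^ (p / p0))%:E).

Definition total_osc r f : \bar R := \int[nu]_x (mean_osc r f x `^ p0).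

Lemma mean_osc_ge0 r f x : 0 <= mean_osc r f x.
Proof.
apply: mule_ge0; first by rewrite inve_ge0.
by apply: integral_ge0 => y _; rewrite lee_fin powR_ge0.
Qed.

Lemma measurable_ball_average r (G : borel S * borel S -> \bar R) :
  measurable_fun setT G -> (forall xy, 0 <= G xy) ->
  measurable_fun setT (fun x : borel S =>
    average mu (ball (x : S) r) (fun y => G (x, y))).
Proof.
move=> mG G0; apply: emeasurable_funM.
  exact (measurable_inv_ball mu_doubling r (mu_ball_lty mu_doubling)).
exact: (measurable_ball_integral mu_doubling r (mu_ball_lty mu_doubling) mG G0).
Qed.

Lemma measurable_mean_osc r f : measurable_fun setT (f : borel S -> R) ->
  measurable_fun setT (mean_osc r f : borel S -> \bar R).
Proof.
move=> mf.
apply: (@measurable_ball_average r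
  (fun xy : borel S * borel S => (`|f xy.1 - f xy.2| `^ (p / p0))%:E)) => //.
apply: (measurable_norm_powR _ (f := fun xy : borel S * borel S => (f xy.1 - f xy.2)%R)).
by apply: measurable_funB; apply: (measurableT_comp mf).
Qed.

Lemma measurable_mean_osc_poweR r f : measurable_fun setT (f : borel S -> R) ->
  measurable_fun setT (fun x : borel S => mean_osc r f x `^ p0).
Proof.
by move=> mf; apply: (measurableT_comp (measurable_poweR _)); exact: measurable_mean_osc.
Qed.

Lemma mean_oscE r f x : (0 < r)%R ->
  \int[mu]_(y in ball x r) (`|f x - f y| `^ q)%:E = mu (ball x r) * mean_osc r f x.
Proof.
move=> r0; rewrite /mean_osc /average muleA divee ?mul1e//.
- exact: mu_ball_fin mu_doubling x r.
- by rewrite gt_eqF// (mu_ball_gt0 mu_doubling).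
Qed.

(** In dist_le_mean_osc, 2^q comes from the quasi-triangle inequality at the
    exponent q = p/p0, C^2 from comparing a ball of radius r with one of
    radius r/2 inside it, and the last 2^p0 from splitting the p0-th power of
    a sum. *)
Definition cell_const : R := ((2 `^ q * C ^+ 2) `^ p0 * 2 `^ p0)%R.

Lemma cell_const_gt0 : (0 < cell_const)%R.
Proof.
have C0 := doubling_const_gt0 mu_doubling.
by rewrite mulr_gt0 ?powR_gt0 ?mulr_gt0 ?exprn_gt0 ?powR_gt0.
Qed.

(** Compare f x and f y with f t and average over t in E = B(z, r/2). As E is
    inside B(x, r) and B(y, r), and these are inside B(z, 2r), each of the two
    averages over E costs at most the factor C^2. *)
Lemma dist_le_mean_osc r f z x y : (0 < r)%R ->
  measurable_fun setT (f : borel S -> R) ->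
  ball z (r / 2)%R x -> ball z (r / 2)%R y ->
  (`|f x - f y| `^ p)%:E <=
    cell_const%:E * (mean_osc r f x `^ p0 + mean_osc r f y `^ p0).
Proof.
move=> r0 mf zx zy.
have C0 := doubling_const_gt0 mu_doubling.
have r20 : (0 < r / 2)%R by rewrite divr_gt0.
pose E : set (borel S) := ball z (r / 2)%R.
have mE : measurable (E : set (borel S)) by exact: measurable_metric_ball.
pose m : R := fine (mu E).
have muE : mu E = m%:E by rewrite fineK// (mu_ball_fin mu_doubling).
have m0 : (0 < m)%R.
  by rewrite fine_gt0// (mu_ball_gt0 mu_doubling)//= (mu_ball_lty mu_doubling).
have mfc (a : R) : measurable_fun setT (fun t : borel S => (`|a - f t| `^ q)%:E).
  by apply: (measurable_norm_powR _ (f := fun t : borel S => (a - f t)%R)); exact: measurable_funB.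
have mfD : measurable_fun setT (fun t : borel S =>
    (`|f x - f t| `^ q)%:E + (`|f y - f t| `^ q)%:E).
  by apply: emeasurable_funD; exact: mfc.
have inner u : ball z (r / 2)%R u ->
    \int[mu]_(t in E) (`|f u - f t| `^ q)%:E <= (C ^+ 2 * m)%:E * mean_osc r f u.
  move=> zu.
  have Eu : E `<=` ball u r.
    by apply: subset_ball; move: zu; rewrite ball_mdist metric_sym; lra.
  apply: (@le_trans _ _ (\int[mu]_(t in ball u r) (`|f u - f t| `^ q)%:E)).
    apply: ge0_subset_integral => //; first exact: measurable_metric_ball.
    by apply: measurable_funTS; exact: mfc.
  rewrite mean_oscE// lee_wpmul2r ?mean_osc_ge0// EFinM -muE.
  apply: le_trans (doubling_iter mu_doubling z 2 r20).
  apply: le_measure; rewrite ?inE; try exact: measurable_metric_ball.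
  apply: subset_ball; move: zu; rewrite ball_mdist => zu.
  by rewrite expr2; lra.
have key : (`|f x - f y| `^ q)%:E <=
    (2 `^ q * C ^+ 2)%:E * (mean_osc r f x + mean_osc r f y).
  have : \int[mu]_(t in E) (`|f x - f y| `^ q)%:E <=
      \int[mu]_(t in E) ((2 `^ q)%:E *
        ((`|f x - f t| `^ q)%:E + (`|f y - f t| `^ q)%:E)).
    apply: ge0_le_integral => //.
    - by apply: measurable_funeM; apply: measurable_funTS; exact: mfD.
    - move=> t _; rewrite -EFinD -EFinM lee_fin.
      have -> : (f x - f y = (f x - f t) + (f t - f y))%R by ring.
      apply: (le_trans (powR_normD _ _ (ltW q_gt0))).
      by rewrite (distrC (f t)).
  rewrite integral_cst// muE ge0_integralZl//; first last.
  - by move=> t _; rewrite adde_ge0.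
  - by apply: measurable_funTS; exact: mfD.
  rewrite ge0_integralD//; try by apply: measurable_funTS; exact: mfc.
  move=> H.
  have {}H : (`|f x - f y| `^ q)%:E * m%:E <= m%:E *
      ((2 `^ q * C ^+ 2)%:E * (mean_osc r f x + mean_osc r f y)).
    apply: (le_trans H).
    rewrite (_ : m%:E * _ = (2 `^ q)%:E * ((C ^+ 2 * m)%:E * mean_osc r f x +
      (C ^+ 2 * m)%:E * mean_osc r f y)); last first.
      rewrite -ge0_muleDr ?mean_osc_ge0// !muleA; congr (_ * _).
      by rewrite -!EFinM; congr (_%:E); ring.
    rewrite lee_pmul2l ?lte_fin ?powR_gt0//.
    by apply: leeD; exact: inner.
  by move: H; rewrite muleC lee_pmul2l// lte_fin.
have -> : (`|f x - f y| `^ p = (`|f x - f y| `^ q) `^ p0)%R.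
  by rewrite -powRrM /q divfK// gt_eqF.
have G0 u := mean_osc_ge0 r f u.
have p00 := ltW p0_gt0.
rewrite -poweR_EFin; apply: (@le_trans _ _ (((2 `^ q * C ^+ 2)%:E *
    (mean_osc r f x + mean_osc r f y)) `^ p0)).
  apply: gt0_ler_poweR => //.
  - by rewrite in_itv /= leey andbT lee_fin powR_ge0.
  - rewrite in_itv /= leey andbT mule_ge0 ?adde_ge0// lee_fin.
    by rewrite mulr_ge0 ?powR_ge0 ?exprn_ge0 ?(ltW C0).
have k0 : (0 <= 2 `^ q * C ^+ 2)%R by rewrite mulr_ge0 ?powR_ge0 ?exprn_ge0 ?(ltW C0).
rewrite poweRM ?adde_ge0//.
rewrite (_ : cell_const%:E = (2 `^ q * C ^+ 2)%:E `^ p0 * (2 `^ p0)%:E); last first.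
  by rewrite poweR_EFin -EFinM.
rewrite -muleA poweR_EFin lee_pmul2l//; last first.
  by rewrite lte_fin powR_gt0// mulr_gt0 ?powR_gt0// exprn_gt0.
exact: poweRD_le.
Qed.

(** The constant is the value of f at a point y of P where nu P times
    (mean_osc r f)^p0 exceeds the integral of (mean_osc r f)^p0 over P by at
    most e, so that both terms of dist_le_mean_osc integrate over P to at most
    the same quantity, up to e. On null
    cells the constant is taken to be 0, which keeps the coefficients of step
    functions bounded. *)
Lemma cell_approx r f (P : set S) z (e : R) : (0 < r)%R -> (0 < e)%R ->
  measurable_fun setT (f : borel S -> R) -> measurable (P : set (borel S)) ->
  P `<=` ball z (r / 2)%R ->
  exists2 c : R, nu P = 0 -> c = 0%R &
    \int[nu]_(x in P) (`|f x - c| `^ p)%:E <=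
      cell_const%:E * (2 * \int[nu]_(x in P) (mean_osc r f x `^ p0) + e%:E).
Proof.
move=> r0 e0 mf mP Pz.
have K0 := cell_const_gt0.
pose I := \int[nu]_(x in P) (mean_osc r f x `^ p0).
have I0 : 0 <= I by apply: integral_ge0 => x _; exact: poweR_ge0.
have mG := measurable_mean_osc_poweR r mf.
have [P0|P0] := eqVneq (nu P) 0.
  exists 0%R => //; rewrite null_set_integral//.
  - by rewrite mule_ge0 ?lee_fin ?(ltW K0)// adde_ge0 ?lee_fin ?(ltW e0)// mule_ge0.
  - apply: measurable_funTS.
    apply: (measurable_norm_powR _ (f := fun t : borel S => (f t - 0)%R)).
    exact: measurable_funB.
have Py : nu P < +oo.
  apply: le_lt_trans (nu_ball_lty z (r / 2)%R).
  by apply: le_measure; rewrite ?inE//; exact: measurable_metric_ball.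
have Pgt0 : 0 < nu P by rewrite lt_neqAle eq_sym P0 measure_ge0.
have [y Py0 yI] : exists2 y, P y & nu P * (mean_osc r f y `^ p0) <= I + e%:E.
  apply: (@exists_le_mean _ _ _ nu P (fun x : borel S => mean_osc r f x `^ p0)) => //;
    first by rewrite Pgt0.
  by move=> x; exact: poweR_ge0.
exists (f y); first by move=> P00; rewrite P00 eqxx in P0.
apply: (@le_trans _ _ (\int[nu]_(x in P)
    (cell_const%:E * (mean_osc r f x `^ p0 + mean_osc r f y `^ p0)))).
  apply: ge0_le_integral => //.
  - apply: measurable_funTS.
    by apply: (measurable_norm_powR _ (f := fun t : borel S => (f t - f y)%R)); exact: measurable_funB.
  - apply: measurable_funeM; apply: emeasurable_funD; last exact: measurable_cst.
    exact: measurable_funTS.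
  - by move=> x Px; apply: dist_le_mean_osc => //; exact: Pz.
rewrite (ge0_integral_affine nu mP (measurable_funTS mG)) ?poweR_ge0 ?(ltW K0)//; last first.
  by move=> x; exact: poweR_ge0.
rewrite lee_pmul2l ?lte_fin// -/I [leLHS]addeC.
apply: (@le_trans _ _ ((I + e%:E) + I)); first by rewrite leeD2r// muleC.
by rewrite muleC mule_natr mule2n addeAC.
Qed.

End mean_oscillation.

(** * Approximation by step functions *)

Section disjoint_cells.
Context (R : realType) (T : Type) (P : (set T)^nat) (n : nat).
Hypothesis tP : trivIset [set: nat] P.
Local Open Scope ring_scope.

Lemma sum_cells (a : 'I_n -> R) (j : 'I_n) x :
  P j x -> \sum_i a i * \1_(P i) x = a j.
Proof.
move=> Pjx; rewrite (bigD1 j)//= indicE mem_set// mulr1 big1 ?addr0// => i ij.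
rewrite indicE memNset ?mulr0// => Pix; move/eqP: ij; apply; apply: val_inj.
by apply: (tP (i := val i) (j := val j)) => //; exists x.
Qed.

Lemma sum_cells0 (a : 'I_n -> R) x :
  (forall j : 'I_n, ~ P j x) -> \sum_i a i * \1_(P i) x = 0.
Proof. by move=> Px; rewrite big1// => i _; rewrite indicE memNset// mulr0. Qed.

End disjoint_cells.

Section approximation.
Context (R : realType) (S : completeMetricType R).
Variables mu nu : {measure set (borel S) -> \bar R}.
Variable C : R.
Hypothesis mu_doubling : doubling_with mu C.
Hypothesis nu_ball_lty : forall (x : S) (r : R), (nu (ball x r) < +oo)%E.
Variables p p0 : R.
Hypotheses (p_gt0 : 0 < p) (p0_gt1 : 1 < p0).
Implicit Types (x y z : S) (r : R) (f g : S -> R).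
Local Open Scope ereal_scope.
Local Notation modular := (modular nu p).
Local Notation cell_const := (cell_const C p p0).
Local Notation total_osc := (total_osc mu nu p p0).

Lemma modular_indic (c : R) (P : set (borel S)) : measurable P ->
  modular (fun x => c * \1_P x)%R = (`|c| `^ p)%:E * nu P.
Proof.
move=> mP; rewrite modularZ//; congr (_ * _).
rewrite -[in RHS](setIT P) -integral_indic//; apply: eq_integral => x _.
rewrite indicE; case: (x \in P); rewrite ?normr1 ?powR1// normr0 powR0//.
by rewrite gt_eqF.
Qed.

Lemma ball_cells x (A r : R) : (0 < A)%R -> (0 < r)%R ->
  exists n (P : (set (borel S))^nat), [/\ trivIset [set: nat] P,
    forall i, measurable (P i),
    forall i, exists z, P i `<=` ball z r &
    \bigcup_(i in `I_n) P i = ball x A].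
Proof.
move=> A0 r0; have [zs zsP] := ball_finite_net mu_doubling x A0 r0.
pose F i : set (borel S) := ball (nth point zs i) r `&` ball x A.
exists (size zs), (seqDU F); split.
- exact: trivIset_seqDU.
- apply: seqDU_measurable => i.
  by apply: measurableI; exact: measurable_metric_ball.
- move=> i; exists (nth point zs i); apply: (subset_trans (@subset_seqDU _ F i)).
  by move=> y [].
rewrite bigcup_mkord -bigsetU_seqDU -bigcup_mkord; apply/seteqP; split.
  by move=> y [i _ []].
move=> y xy; have [z zzs zy] := zsP _ xy.
by exists (index z zs); rewrite /= ?index_mem// /F nth_index.
Qed.

(** The cells being disjoint, the estimates of cell_approx add up, and the
    integrals over the cells of (mean_osc r f)^p0 sum to at most
    total_osc r f. *)
Lemma cells_approx (f : S -> R) x (A r : R) n (P : (set (borel S))^nat) (e : R) :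
  (0 < r)%R -> (0 < e)%R -> measurable_fun setT (f : borel S -> R) ->
  trivIset [set: nat] P -> (forall i, measurable (P i)) ->
  (forall i, exists z, P i `<=` ball z (r / 2)%R) ->
  \bigcup_(i in `I_n) P i = ball x A ->
  exists2 c : 'I_n -> R, forall i : 'I_n, nu (P i) = 0 -> c i = 0%R &
    modular ((f \* \1_(ball x A)) \- (fun x => \sum_i c i * \1_(P i) x))%R <=
      cell_const%:E * (2 * total_osc r f + (n%:R * e)%:E).
Proof.
move=> r0 e0 mf tP mP Pz PU.
have K0 := cell_const_gt0 mu_doubling p p0.
have /choice[c Hc] (i : 'I_n) : exists c : R, (nu (P i) = 0 -> c = 0%R) /\
    \int[nu]_(x in P i) (`|f x - c| `^ p)%:E <=
      cell_const%:E * (2 * \int[nu]_(x in P i) (mean_osc mu p p0 r f x `^ p0) + e%:E).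
  have [z Pzi] := Pz i.
  have [c c0 ci] := cell_approx mu_doubling nu_ball_lty p_gt0 p0_gt1 r0 e0 mf (mP i) Pzi.
  by exists c.
exists c; first by move=> i; exact: (Hc i).1.
have mG := measurable_mean_osc_poweR mu_doubling p p0 r mf.
have mfc (a : R) : measurable_fun setT (fun t : borel S => (`|f t - a| `^ p)%:E).
  by apply: (measurable_norm_powR _ (f := fun t : borel S => (f t - a)%R)); exact: measurable_funB.
have mD : measurable_fun setT ((f \* \1_(ball x A)) \-
    (fun x => \sum_i c i * \1_(P i) x) : borel S -> R)%R.
  apply: measurable_funB.
    by apply: measurable_funM => //; apply: measurable_indic; exact: measurable_metric_ball.
  by apply: measurable_sum => i; apply: measurable_funM.
have PUn : \big[setU/set0]_(i < n) P i = ball x A by rewrite -bigcup_mkord.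
apply: (@le_trans _ _ (\sum_(i < n) \int[nu]_(x in P i) (`|f x - c i| `^ p)%:E)).
  apply: (@le_trans _ _ (\sum_(i < n) \int[nu]_x ((`|f x - c i| `^ p)%:E * (\1_(P i) x)%:E))).
    rewrite -ge0_integral_sum//; first last.
      move=> i; apply: emeasurable_funM; first exact: mfc.
      exact/measurable_EFinP.
    rewrite /modular; apply: ge0_le_integral => //.
    - exact: measurable_norm_powR mD.
    - apply: emeasurable_sum => i; apply: emeasurable_funM; first exact: mfc.
      exact/measurable_EFinP.
    move=> y _ /=.
    have [xy|xy] := pselect (ball x A y); last first.
      rewrite indicE memNset// mulr0 sum_cells0; last first.
        by move=> j Pj; apply: xy; rewrite -PU; exists j => /=.
      by rewrite subr0 normr0 powR0 ?gt_eqF// sume_ge0// => i _; rewrite mule_ge0.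
    rewrite indicE mem_set// mulr1.
    have [j jn Pj] : (\bigcup_(i in `I_n) P i) y by rewrite PU.
    rewrite (sum_cells tP c (j := Ordinal jn))//.
    rewrite (bigD1 (Ordinal jn))//= indicE mem_set// mule1 leeDl// sume_ge0//.
  apply: lee_sum => i _; rewrite [leRHS]integral_mkcond epatch_indic.
  exact: le_refl.
apply: (@le_trans _ _ (\sum_(i < n) cell_const%:E *
    (2 * \int[nu]_(x in P i) (mean_osc mu p p0 r f x `^ p0) + e%:E))).
  by apply: lee_sum => i _; exact: (Hc i).2.
rewrite -ge0_sume_distrr; last first.
  move=> i _; rewrite adde_ge0 ?mule_ge0 ?lee_fin ?(ltW e0)//.
  by apply: integral_ge0 => y _; exact: poweR_ge0.
rewrite lee_pmul2l ?lte_fin// big_split/= leeD//; last first.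
  by rewrite sumEFin lee_fin sumr_const card_ord mulr_natl.
rewrite -ge0_sume_distrr; last first.
  by move=> i _; apply: integral_ge0 => y _; exact: poweR_ge0.
rewrite lee_pmul2l//.
rewrite -(@ge0_integral_bigsetU _ _ _ nu _ (fun i : 'I_n => P i)
  (fun x : borel S => mean_osc mu p p0 r f x `^ p0))//; first last.
- by move=> y _; exact: poweR_ge0.
- exact: measurable_funTS.
- by move=> i j _ _ /(tP i j I I)/val_inj.
- exact: index_enum_uniq.
apply: ge0_subset_integral => //.
- exact: bigsetU_measurable.
- by move=> y _; exact: poweR_ge0.
Qed.

(** The step function is close to f on the ball, so its modular is at most
    2^p (b + M), and a single term |c i|^p nu (P i) is at most that modular. *)
Lemma cells_coef_le (f : S -> R) x (A : R) n (P : (set (borel S))^nat)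
    (c : 'I_n -> R) (M b : R) (i : 'I_n) :
  measurable_fun setT (f : borel S -> R) ->
  trivIset [set: nat] P -> (forall i, measurable (P i)) ->
  nu (P i) < +oo -> (nu (P i) = 0 -> c i = 0%R) ->
  modular f <= M%:E ->
  modular ((f \* \1_(ball x A)) \- (fun x => \sum_i c i * \1_(P i) x))%R <= b%:E ->
  (`|c i| <= (2 `^ p * (b + M) / fine (nu (P i))) `^ p^-1)%R.
Proof.
move=> mf tP mP Py c0 fM cb.
have [P0|P0] := eqVneq (nu (P i)) 0; first by rewrite c0// normr0 powR_ge0.
have pN0 : (p != 0)%R by rewrite gt_eqF.
have mfB : measurable_fun setT (f \* \1_(ball x A) : borel S -> R)%R.
  by apply: measurable_funM => //; apply: measurable_indic; exact: measurable_metric_ball.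
have ms : measurable_fun setT (fun x : borel S => \sum_i c i * \1_(P i) x)%R.
  by apply: measurable_sum => j; apply: measurable_funM.
have Pgt0 : (0 < fine (nu (P i)))%R.
  by rewrite fine_gt0// Py andbT lt_neqAle eq_sym P0 measure_ge0.
have H : (`|c i| `^ p)%:E * nu (P i) <= (2 `^ p * (b + M))%:E.
  rewrite -modular_indic//.
  apply: (@le_trans _ _ (modular (fun x : borel S => \sum_i c i * \1_(P i) x)%R)).
    apply: modular_le => //.
      by apply: measurable_funM => //; exact: measurable_indic.
    move=> y; have [Py'|Py'] := pselect (P i y).
      by rewrite (sum_cells tP c (j := i))// indicE mem_set// mulr1.
    by rewrite indicE memNset// mulr0 normr0.
  rewrite modularBC in cb; apply: (modular_split_le p_gt0 ms mfB cb).
  apply: le_trans fM; apply: modular_le => // y.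
  by rewrite /= indicE normrM; case: (y \in _); rewrite ?normr1 ?mulr1// normr0 mulr0.
have {}H : (`|c i| `^ p <= 2 `^ p * (b + M) / fine (nu (P i)))%R.
  move: H; rewrite -{1}(@fineK _ (nu (P i))) ?ge0_fin_numE// -EFinM lee_fin.
  by rewrite ler_pdivlMr.
have -> : `|c i|%R = ((`|c i| `^ p) `^ p^-1)%R by rewrite -powRrM mulfV// powRr1.
apply: ge0_ler_powR; rewrite ?invr_ge0 ?(ltW p_gt0)// ?nnegrE ?powR_ge0//.
by apply: (le_trans _ H); exact: powR_ge0.
Qed.

(** The radius A, the scale r and the cells are chosen from the uniform
    conditions, before f; only the coefficients depend on f. *)
Lemma conditions_finitely_approximable (K : set (Lp nu p_gt0)) x0 :
  (exists M : R, forall f : Lp nu p_gt0, K f -> modular f <= M%:E) ->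
  (forall e : R, (0 < e)%R -> exists2 A, (0 < A)%R & forall f : Lp nu p_gt0, K f ->
    modular (f \* \1_(~` ball x0 A))%R <= e%:E) ->
  (forall e : R, (0 < e)%R -> exists2 r, (0 < r)%R & forall f : Lp nu p_gt0, K f ->
    total_osc r f <= e%:E) ->
  finitely_approximable K.
Proof.
move=> [M KM] Ktail Kosc e e0.
have K0 := cell_const_gt0 mu_doubling p p0.
have KN0 : cell_const != 0%R by rewrite gt_eqF.
have k0 : (0 < 2 `^ p :> R)%R by rewrite powR_gt0.
have kN0 : (2 `^ p != 0 :> R)%R by rewrite gt_eqF.
(* e1 is the error allowed for the tail and for the step function; h and de
   split the latter between the oscillation and the slack of the n cells *)
pose e1 : R := (e / (2 `^ p * 2))%R.
have e10 : (0 < e1)%R by rewrite divr_gt0// mulr_gt0.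
have [A A0 KA] := Ktail _ e10.
pose h : R := (e1 / (4 * cell_const))%R.
have h0 : (0 < h)%R by rewrite divr_gt0// mulr_gt0.
have [r r0 Kr] := Kosc _ h0.
have [n [P [tP mP Pz PU]]] := ball_cells x0 A0 (divr_gt0 r0 (ltr0n R 2)).
pose de : R := (e1 / (2 * cell_const * n.+1%:R))%R.
have de0 : (0 < de)%R.
  apply: divr_gt0 => //; apply: mulr_gt0; last by rewrite ltr0n.
  exact: mulr_gt0.
have Py i : nu (P i) < +oo.
  have [z Pzi] := Pz i; apply: le_lt_trans (nu_ball_lty z (r / 2)%R).
  by apply: le_measure; rewrite ?inE//; exact: measurable_metric_ball.
have mB : measurable (ball x0 A : set (borel S)) by exact: measurable_metric_ball.
exists n, (fun i : 'I_n => \1_(P i)),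
  (\sum_(i < n) (2 `^ p * (e1 + M) / fine (nu (P i))) `^ p^-1)%R; split.
  move=> i; split; first exact: measurable_indic.
  rewrite (_ : \1_(P i) = fun x => 1 * \1_(P i) x)%R; last first.
    by apply/funext => x; rewrite mul1r.
  by rewrite modular_indic// normr1 powR1 mul1e.
move=> f Kf; have mf := measurable_Lp f.
have [c c0 cb] := cells_approx r0 de0 mf tP mP Pz PU.
have {}cb : modular ((f \* \1_(ball x0 A)) \-
    (fun x => \sum_i c i * \1_(P i) x))%R <= e1%:E.
  apply: (le_trans cb).
  apply: (@le_trans _ _ (cell_const%:E * (2 * h%:E + (n%:R * de)%:E))).
    by rewrite lee_pmul2l ?lte_fin// leeD2r// lee_pmul2l//; exact: Kr.
  change ((cell_const * (2 * h + n%:R * de))%:E <= e1%:E); rewrite lee_fin.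
  have ne : (n%:R * de <= e1 / (2 * cell_const))%R.
    have nS : (n.+1%:R != 0 :> R)%R by rewrite pnatr_eq0.
    have -> : (n%:R * de = e1 / (2 * cell_const) * (n%:R / n.+1%:R))%R.
      rewrite /de; move: nS; move: (n.+1%:R : R) => N nS.
      by field; rewrite nS KN0.
    rewrite ler_piMr//; first by rewrite ltW// divr_gt0// mulr_gt0.
    by rewrite ler_pdivrMr ?ltr0n// mul1r ler_nat.
  apply: (@le_trans _ _ (cell_const * (2 * h + e1 / (2 * cell_const))))%R.
    by rewrite ler_wpM2l ?(ltW K0)// lerD2l.
  rewrite (_ : _ * _ = e1)%R// /h; field; rewrite KN0/=.
  by [].
exists c; split.
  move=> i; apply: (le_trans (cells_coef_le mf tP mP (Py i) (c0 i) (KM _ Kf) cb)).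
  by rewrite (bigD1 i)//= lerDl sumr_ge0// => j _; exact: powR_ge0.
have mfB : measurable_fun setT (f \* \1_(ball x0 A) : borel S -> R)%R.
  by apply: measurable_funM => //; apply: measurable_indic.
have ms : measurable_fun setT (fun x : borel S => \sum_i c i * \1_(P i) x)%R.
  by apply: measurable_sum => j; apply: measurable_funM.
have ft : modular (f \- (f \* \1_(ball x0 A)))%R <= e1%:E.
  rewrite (_ : (f \- _)%R = (f \* \1_(~` ball x0 A))%R); first exact: KA.
  apply/funext => y /=; rewrite !indicE in_setC.
  by case: (y \in _); rewrite ?mulr1 ?mulr0 ?subrr ?subr0.
apply: (le_trans (modular_triangle_le p_gt0 mf mfB ms ft cb)); rewrite lee_fin.
by rewrite (_ : _ * _ = e)%R// /e1; field.
Qed.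

End approximation.

(** * Measures with a density *)

Import HBNNSimple.

Lemma nnsfun_sum_indic d (T : measurableType d) (R : realType)
    (h : {nnsfun T >-> R}) :
  exists n (a : 'I_n -> R) (A : 'I_n -> set T),
    [/\ forall i, 0 <= a i, forall i, measurable (A i) &
        forall x, h x = \sum_i a i * \1_(A i) x].
Proof.
pose s : seq R := finmap.enum_fset (fset_set (range h)).
have sE y : y \in s -> exists x, h x = y.
  by rewrite /s in_fset_set// inE => -[x _ <-]; exists x.
exists (size s), (fun i => nth 0 s i), (fun i => h @^-1` [set nth 0 s i]); split.
- move=> i; have /sE[x <-] : nth 0 s i \in s by exact: mem_nth.
  exact: fun_ge0.
- by move=> i; exact: measurable_sfunP.
move=> x; rewrite fimfunE fsbig_finite//=.
rewrite (big_nth 0) big_mkord.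
by apply: eq_bigr => i _.
Qed.

Section weighted.
Context d (T : measurableType d) (R : realType).
Variables (mu : {measure set T -> \bar R}) (w : weight mu).
Local Open Scope ereal_scope.
Local Notation nu := (weighted_measure w).

(** A real-valued, everywhere positive version of w: it equals w almost
    everywhere, and spares the exceptional set in all later formulas. *)
Definition weight_density (x : T) : R :=
  if 0 < w x < +oo then fine (w x) else 1%R.

Lemma weight_density_gt0 x : (0 < weight_density x)%R.
Proof. by rewrite /weight_density; case: ifPn => // wx; rewrite fine_gt0. Qed.

Lemma measurable_weight_density : measurable_fun setT weight_density.
Proof.
have mw := measurable_weight w.
apply: measurable_fun_ifT => //.
  by apply: measurable_and; exact: measurable_fun_lte.
by apply: (measurableT_comp (fine_measurable measurableT)).
Qed.

Lemma weight_densityE : {ae mu, forall x, w x = (weight_density x)%:E}.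
Proof.
apply: filterS (weight_ae w) => x wx.
by rewrite /weight_density wx fineK// gt0_fin_numE// ; case/andP: wx.
Qed.

Local Notation v := weight_density.
Hint Resolve weight_density_gt0 : core.
Let v_ge0 x : 0 <= (v x)%:E. Proof. by rewrite lee_fin ltW. Qed.
Let mv : measurable_fun setT (fun x => (v x)%:E).
Proof. exact/measurable_EFinP/measurable_weight_density. Qed.

Lemma weighted_measureE A : measurable A -> nu A = \int[mu]_(x in A) (v x)%:E.
Proof.
move=> mA; rewrite /weighted_measure; apply: ae_eq_integral => //.
- by apply: measurable_funTS; exact/measurable_funepos/measurable_weight.
- exact: measurable_funTS.
- apply: filterS weight_densityE => x wx _.
  by rewrite funeposE wx; apply/max_idPl.
Qed.

(** True for indicators by definition of the weighted measure, hence for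
    nonnegative simple functions by linearity and in general by monotone
    convergence. *)
Lemma ge0_integral_weighted (g : T -> \bar R) : measurable_fun setT g ->
  (forall x, 0 <= g x) -> \int[nu]_x g x = \int[mu]_x (g x * (v x)%:E).
Proof.
move=> mg g0.
pose h := nnsfun_approx measurableT mg.
have mh n : measurable_fun setT (fun x => (h n x)%:E).
  exact/measurable_EFinP.
have hc x : (fun n => (h n x)%:E) @ \oo --> g x by exact: cvg_nnsfun_approx.
have h_nd x : {homo (fun n => (h n x)%:E) : a b / (a <= b)%N >-> a <= b}.
  by move=> a b ab; rewrite lee_fin; exact/lefP/nd_nnsfun_approx.
transitivity (limn (fun n => \int[nu]_x (h n x)%:E)).
  rewrite -monotone_convergence//.
    by apply: eq_integral => x _; apply/esym/cvg_lim => //; exact: hc.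
  by move=> n x _; rewrite lee_fin.
transitivity (limn (fun n => \int[mu]_x ((h n x)%:E * (v x)%:E))); last first.
  rewrite -monotone_convergence//.
  - apply: eq_integral => x _; apply/cvg_lim => //.
    by apply: cvgeZr => //; exact: hc.
  - by move=> n; exact: emeasurable_funM.
  - by move=> n x _; rewrite mule_ge0// lee_fin.
  - by move=> x _ a b ab; rewrite lee_wpmul2r//; exact: h_nd.
congr (limn _); apply/funext => n.
have [k [a [A [a0 mA hA]]]] := nnsfun_sum_indic (h n).
have mI i : measurable_fun setT (fun x => (a i)%:E * (\1_(A i) x)%:E).
  by apply: measurable_funeM; apply/measurable_EFinP.
transitivity (\sum_(i < k) \int[nu]_x ((a i)%:E * (\1_(A i) x)%:E)).
  rewrite -ge0_integral_sum//; last by move=> i x _; rewrite mule_ge0// lee_fin.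
  apply: eq_integral => x _; rewrite hA -sumEFin.
  by apply: eq_bigr => i _; rewrite EFinM.
transitivity (\sum_(i < k) \int[mu]_x ((a i)%:E * (\1_(A i) x)%:E * (v x)%:E)); last first.
  rewrite -ge0_integral_sum//; first last.
  - by move=> i x _; rewrite !mule_ge0// lee_fin.
  - by move=> i; exact: emeasurable_funM.
  apply: eq_integral => x _; rewrite hA -sumEFin ge0_sume_distrl.
    by apply: eq_bigr => i _; rewrite EFinM.
  by move=> i _; rewrite lee_fin mulr_ge0.
apply: eq_bigr => i _; rewrite ge0_integralZl ?lee_fin//; last exact/measurable_EFinP.
rewrite integral_indic// setIT.
under [RHS]eq_integral do rewrite -muleA.
rewrite ge0_integralZl//; first last.
- by rewrite lee_fin.
- by move=> x _; rewrite mule_ge0// lee_fin.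
- by apply: emeasurable_funM => //; apply/measurable_EFinP.
congr (_ * _); rewrite [LHS]weighted_measureE// integral_mkcond epatch_indic.
by apply: eq_integral => x _; rewrite muleC.
Qed.

End weighted.

(** * Muckenhoupt weights *)

Section weighted_hoelder.
Context d (T : measurableType d) (R : realType).
Variables (mu : {measure set T -> \bar R}) (v g : T -> R) (B : set T) (q : R).
Hypotheses (mB : measurable B) (mv : measurable_fun setT v)
  (mg : measurable_fun setT g).
Hypotheses (v_gt0 : forall x, 0 < v x) (g_ge0 : forall x, 0 <= g x).
Hypothesis q_gt1 : 1 < q.
Local Open Scope ereal_scope.

(** Hoelder's inequality with exponents q and q' for the factorisation
    g = (g v^(1/q)) v^(-1/q), raised to the power q; note that
    v^(-q'/q) = v^(1-q') and q/q' = q - 1. *)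
Lemma hoelder_weighted :
  (\int[mu]_(x in B) (g x)%:E) `^ q <=
  (\int[mu]_(x in B) ((g x `^ q)%:E * (v x)%:E)) *
  (\int[mu]_(x in B) (v x `^ (1 - conj_exponent q))%:E) `^ (q - 1).
Proof.
have q0 : (0 < q)%R by exact: lt_trans q_gt1.
have qN0 : (q != 0)%R by rewrite gt_eqF.
have q10 : (0 < q - 1)%R by rewrite subr_gt0.
have q1N0 : (q - 1 != 0)%R by rewrite gt_eqF.
pose q' := conj_exponent q.
have q'0 : (0 < q')%R by rewrite divr_gt0.
have qq' : (q^-1 + q'^-1 = 1)%R by rewrite /q' /conj_exponent; field; rewrite qN0 q1N0.
pose f1 x := (g x * v x `^ q^-1 * \1_B x)%R.
pose f2 x := (v x `^ (- q^-1) * \1_B x)%R.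
have mvp (s : R) : measurable_fun setT (fun x => v x `^ s)%R.
  exact: (measurableT_comp (measurable_powR _)).
have m1 : measurable_fun setT f1.
  apply: measurable_funM; last exact: measurable_indic.
  by apply: measurable_funM.
have m2 : measurable_fun setT f2.
  by apply: measurable_funM; last exact: measurable_indic.
have := hoelder mu m1 m2 q0 q'0 qq'.
have -> : 'N[mu]_1[EFin \o (f1 \* f2)%R] = \int[mu]_(x in B) (g x)%:E.
  rewrite Lnorm1 [RHS]integral_mkcond epatch_indic; apply: eq_integral => x _ /=.
  rewrite /f1 /f2 /= indicE; case: (x \in B); rewrite ?mulr0 ?mule0 ?normr0//.
  rewrite !mulr1 mule1 -mulrA -powRD; last by apply/implyP => _; rewrite gt_eqF.
  by rewrite subrr powRr0 mulr1 ger0_norm.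
have -> : 'N[mu]_q%:E[EFin \o f1] =
    (\int[mu]_(x in B) ((g x `^ q)%:E * (v x)%:E)) `^ q^-1.
  rewrite unlock; congr (_ `^ _); rewrite [RHS]integral_mkcond epatch_indic.
  apply: eq_integral => x _ /=; rewrite /f1 indicE.
  case: (x \in B); rewrite ?mulr0 ?mule0 ?normr0 ?powR0//.
  rewrite mulr1 mule1 ger0_norm ?mulr_ge0 ?powR_ge0//.
  by rewrite powRM ?powR_ge0// -powRrM mulVf// powRr1 ?ltW.
have -> : 'N[mu]_q'%:E[EFin \o f2] =
    (\int[mu]_(x in B) (v x `^ (1 - conj_exponent q))%:E) `^ q'^-1.
  rewrite unlock; congr (_ `^ _); rewrite [RHS]integral_mkcond epatch_indic.
  apply: eq_integral => x _ /=; rewrite /f2 indicE.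
  case: (x \in B); rewrite ?mulr0 ?mule0 ?normr0 ?powR0 ?gt_eqF//.
  rewrite mulr1 mule1 ger0_norm ?powR_ge0// -powRrM.
  congr (_%:E); congr (_ `^ _)%R; rewrite /q' /conj_exponent.
  by field; rewrite qN0 q1N0.
set I := \int[mu]_(x in B) (g x)%:E.
set G := \int[mu]_(x in B) _; set V := \int[mu]_(x in B) _ => H.
have I0 : 0 <= I by apply: integral_ge0 => x _; rewrite lee_fin.
have G0 : 0 <= G.
  by apply: integral_ge0 => x _; rewrite mule_ge0// lee_fin ?powR_ge0// ltW.
have V0 : 0 <= V by apply: integral_ge0 => x _; rewrite lee_fin powR_ge0.
apply: (@le_trans _ _ ((G `^ q^-1 * V `^ q'^-1) `^ q)).
  apply: gt0_ler_poweR => //; first exact: ltW.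
  - by rewrite in_itv /= leey andbT.
  - by rewrite in_itv /= leey andbT mule_ge0 ?poweR_ge0.
rewrite poweRM ?poweR_ge0// -!poweRrM mulVf// poweRe1//.
by rewrite (_ : q'^-1 * q = q - 1)%R// /q' /conj_exponent; field; rewrite qN0 q1N0.
Qed.

End weighted_hoelder.

(** The form in which the A_q condition on nu = w dmu is used. Divided by
    nu(B) mu(B)^q, it bounds the q-th power of a mu-mean by a nu-mean; the
    product form avoids divisions in the extended reals. It speaks of nu only,
    no longer of a density. *)
Definition ball_mean_bound (R : realType) (S : completeMetricType R)
    (mu nu : {measure set (borel S) -> \bar R}) (q M : R) :=
  forall (x : S) r, 0 < r -> forall g : borel S -> R,
  measurable_fun setT g -> (forall y, 0 <= g y) ->
  (nu (ball x r) * (\int[mu]_(y in ball x r) (g y)%:E) `^ q <=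
    M%:E * (mu (ball x r) `^ q * \int[nu]_(y in ball x r) (g y `^ q)%:E))%E.

Section muckenhoupt_weights.
Context (R : realType) (S : completeMetricType R).
Variables (mu : {measure set (borel S) -> \bar R}) (w : weight mu).
Variable C : R.
Hypothesis mu_doubling : doubling_with mu C.
Variables p p0 : R.
Hypothesis p0_gt1 : 1 < p0.
Hypothesis w_Ap0 : muckenhoupt mu p0 w.
Local Open Scope ereal_scope.
Local Notation nu := (weighted_measure w).
Local Notation v := (weight_density w).

Let p0_gt0 : (0 < p0)%R := lt_trans ltr01 p0_gt1.
Let mv : measurable_fun setT (v : borel S -> R) := measurable_weight_density w.
Let mvE : measurable_fun setT (fun x : borel S => (v x)%:E).
Proof. exact/measurable_EFinP. Qed.

Lemma ge0_integral_weighted_in (B : set (borel S)) (g : borel S -> \bar R) :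
  measurable B -> measurable_fun setT g -> (forall x, 0 <= g x) ->
  \int[nu]_(x in B) g x = \int[mu]_(x in B) (g x * (v x)%:E).
Proof.
move=> mB mg g0; rewrite integral_mkcond [RHS]integral_mkcond !epatch_indic.
rewrite ge0_integral_weighted.
- by apply: eq_integral => x _ /=; rewrite muleAC.
- by apply: emeasurable_funM => //; exact/measurable_EFinP.
- by move=> x; rewrite mule_ge0// lee_fin.
Qed.

Lemma integral_ball_gt0 (h : borel S -> R) x r : (0 < r)%R ->
  measurable_fun setT h -> (forall y, 0 < h y)%R ->
  0 < \int[mu]_(y in ball (x : S) r) (h y)%:E.
Proof.
move=> r0 mh h0; have mB := measurable_metric_ball x r.
rewrite lt_neqAle integral_ge0 ?andbT; last by move=> y _; rewrite lee_fin ltW.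
apply/eqP => /esym I0.
have I0' : \int[mu]_(y in ball (x : S) r) `|(h y)%:E| = 0.
  by rewrite -[RHS]I0; apply: eq_integral => y _; rewrite gee0_abs// lee_fin ltW.
have mh' : measurable_fun (ball x r : set (borel S)) (EFin \o h).
  exact/measurable_funTS/measurable_EFinP.
have /(ae_eq_integral_abs mu mB mh')[N [mN N0 hN]] := I0'.
have : mu (ball x r) <= mu N.
  apply: le_measure; rewrite ?inE// => y xy; apply: hN => /= H.
  by have [/eqP] := H xy; rewrite gt_eqF.
by rewrite N0 leNgt (mu_ball_gt0 mu_doubling).
Qed.

(** The powers of the extended-real w and of its real version agree almost
    everywhere, so the A_p0 supremum is the same for both. *)
Lemma muckenhoupt_bound : exists2 M : R, (0 < M)%R & forall (x : S) r, (0 < r)%R ->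
  average mu (ball x r) (fun y => (v y)%:E) *
  average mu (ball x r) (fun y => (v y `^ (1 - conj_exponent p0))%:E) `^ (p0 - 1)
   <= M%:E.
Proof.
move: w_Ap0; rewrite /muckenhoupt; set A := (X in ereal_sup X) => Ay.
pose M : R := (`|fine (ereal_sup A)| + 1)%R.
have AM : ereal_sup A <= M%:E.
  move: Ay; rewrite /M; case: (ereal_sup A) => [s||]//= _; last by rewrite leNye.
  by rewrite lee_fin (le_trans (ler_norm s))// lerDl.
exists M; first by rewrite /M ltr_wpDl.
move=> x r r0; apply: le_trans AM; apply: ereal_sup_ubound.
exists (ball x r); first by exists x, r.
have mB := measurable_metric_ball x r.
have wv := weight_densityE w.
congr (_ * _).
  congr (_ * _); apply: ae_eq_integral => //.
  - exact/measurable_funTS/measurable_weight.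
  - exact/measurable_funTS.
  - by apply: filterS wv => y -> _.
congr (_ `^ _); congr (_ * _); apply: ae_eq_integral => //.
- apply: measurable_funTS; apply: (measurableT_comp (measurable_poweR _)).
  exact: measurable_weight.
- apply: measurable_funTS; apply/measurable_EFinP.
  exact: (measurableT_comp (measurable_powR _)).
- by apply: filterS wv => y -> _.
Qed.

Lemma weighted_ball_gt0 (x : S) r : (0 < r)%R -> 0 < nu (ball x r).
Proof.
move=> r0; rewrite weighted_measureE; last exact: measurable_metric_ball.
by apply: integral_ball_gt0 => // y; exact: weight_density_gt0.
Qed.

(** hoelder_weighted bounds the left-hand side by the nu-integral of g^p0 times
    the product of w(B) and the (p0 - 1)-th power of the integral of the dual
    weight, and the A_p0 condition bounds that product by M mu(B)^p0. The
    same product being finite with a positive second factor makes nu finite on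
    balls. *)
Lemma muckenhoupt_ball_mean : exists M : R,
  [/\ (0 < M)%R, forall (x : S) r, nu (ball x r) < +oo &
      ball_mean_bound mu nu p0 M].
Proof.
have [M M0 HM] := muckenhoupt_bound; exists M.
suff main (x : S) r : (0 < r)%R -> nu (ball x r) < +oo /\
    forall g : borel S -> R, measurable_fun setT g -> (forall y, 0 <= g y)%R ->
      nu (ball x r) * (\int[mu]_(y in ball x r) (g y)%:E) `^ p0 <=
      M%:E * (mu (ball x r) `^ p0 * \int[nu]_(y in ball x r) (g y `^ p0)%:E).
  split => // [x r|x r r0]; last exact: (main x r r0).2.
  by have [r0|/ball_empty ->] := ltP 0%R r;
    [exact: (main x r r0).1|rewrite measure0 ltry].
move=> r0.
have mB := measurable_metric_ball x r.
have := HM x r r0; rewrite /average.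
pose sg y : R := (v y `^ (1 - conj_exponent p0))%R.
have msg : measurable_fun setT (sg : borel S -> R).
  exact: (measurableT_comp (measurable_powR _)).
have V0 : 0 < \int[mu]_(y in ball x r) (v y)%:E.
  by apply: integral_ball_gt0 => // y; exact: weight_density_gt0.
have S0 : 0 < \int[mu]_(y in ball x r) (sg y)%:E.
  by apply: integral_ball_gt0 => // y; rewrite powR_gt0// weight_density_gt0.
rewrite weighted_measureE//.
set V := \int[mu]_(y in ball x r) (v y)%:E in V0 *.
rewrite -/sg; set Sg := \int[mu]_(y in ball x r) (sg y)%:E in S0 *.
have m0 : 0 < mu (ball x r) by rewrite (mu_ball_gt0 mu_doubling).
have my : mu (ball x r) < +oo := mu_ball_lty mu_doubling x r.
move: m0 my; case: (mu (ball x r)) => // m; rewrite !lte_fin => m0 _.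
have mN0 : (m != 0)%R by rewrite gt_eqF.
rewrite inver (negbTE mN0) => VS.
have im0 : (0 < m^-1)%R by rewrite invr_gt0.
have mS0 : 0 < (m^-1%:E * Sg) `^ (p0 - 1) by rewrite poweR_gt0// mule_gt0.
have mV0 : 0 < m^-1%:E * V by rewrite mule_gt0.
(* if V were infinite, the product bounded by M would be too *)
have Vy : V < +oo.
  rewrite ltNge leye_eq; apply/negP => /eqP Vy; move: VS.
  by rewrite Vy (gt0_muley (x := m^-1%:E))// gt0_mulye.
split => // g mg g0.
have := hoelder_weighted mu mB mv mg (weight_density_gt0 w) g0 p0_gt1.
rewrite -/sg -/Sg -(ge0_integral_weighted_in (g := fun y => (g y `^ p0)%:E) mB)//; last 2 first.
- by apply/measurable_EFinP; exact: (measurableT_comp (measurable_powR _)).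
- by move=> y; rewrite lee_fin powR_ge0.
set G := \int[nu]_(y in _) _ => H.
have G0 : 0 <= G by apply: integral_ge0 => y _; rewrite lee_fin powR_ge0.
apply: (@le_trans _ _ (V * (G * Sg `^ (p0 - 1)))).
  by rewrite lee_wpmul2l// ltW.
have -> : V * (G * Sg `^ (p0 - 1)) =
    (m `^ p0)%:E * G * (m^-1%:E * V * (m^-1%:E * Sg) `^ (p0 - 1)).
  rewrite poweRM ?lee_fin ?(ltW im0)// ?(ltW S0)//.
  rewrite poweR_EFin.
  have mm : (m `^ p0 * m^-1 * m^-1 `^ (p0 - 1) = 1)%R.
    rewrite -[X in (X `^ (p0 - 1))%R]powR_inv1 ?(ltW m0)// -powRrM.
    rewrite -[X in (_ * X * _)%R]powR_inv1 ?(ltW m0)// -!powRD; last 2 first.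
    - by apply/implyP => _.
    - by apply/implyP => _.
    by rewrite (_ : _ + _ = 0)%R ?powRr0//; ring.
  transitivity ((m `^ p0 * m^-1 * m^-1 `^ (p0 - 1))%:E * (V * (G * Sg `^ (p0 - 1)))).
    by rewrite mm mul1e.
  rewrite !EFinM -!muleA; congr (_ * _).
  rewrite [RHS]muleCA; congr (_ * _); rewrite [V * (G * _)]muleCA [LHS]muleCA.
  by congr (_ * _); rewrite muleCA.
rewrite [leRHS]muleC poweR_EFin lee_wpmul2l//.
by rewrite mule_ge0// lee_fin powR_ge0.
Qed.

(** The mean oscillations being measurable in x, the integral against w dmu can
    be taken against the weighted measure. *)
Lemma oscillationE r (f : S -> R) : measurable_fun setT (f : borel S -> R) ->
  oscillation w p p0 r f = total_osc mu nu p p0 r f.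
Proof.
move=> mf; have mG := measurable_mean_osc_poweR mu_doubling p p0 r mf.
rewrite /total_osc ge0_integral_weighted//; last by move=> x; exact: poweR_ge0.
apply: ae_eq_integral => //.
- by apply: emeasurable_funM => //; exact: measurable_weight.
- exact: emeasurable_funM.
- by apply: filterS (weight_densityE w) => x -> _.
Qed.

End muckenhoupt_weights.

(** * Averaging operators *)

Section averaging.
Context (R : realType) (S : completeMetricType R).
Variables mu nu : {measure set (borel S) -> \bar R}.
Variable C : R.
Hypothesis mu_doubling : doubling_with mu C.
Hypothesis nu_ball_lty : forall (x : S) (r : R), (nu (ball x r) < +oo)%E.
Hypothesis nu_ball_gt0 : forall (x : S) (r : R), 0 < r -> (0 < nu (ball x r))%E.
Variables p0 M : R.
Hypotheses (p0_gt1 : 1 < p0) (M_gt0 : 0 < M).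
Hypothesis nu_mean : ball_mean_bound mu nu p0 M.
Implicit Types (x y z : S) (r : R) (f g : S -> R).
Local Open Scope ereal_scope.

Let p0_gt0 : (0 < p0)%R := lt_trans ltr01 p0_gt1.
Let p0N0 : (p0 != 0)%R. Proof. by rewrite gt_eqF. Qed.
Let C_gt0 : (0 < C)%R := doubling_const_gt0 mu_doubling.

Definition nu_doubling_const : R := (M * C `^ p0)%R.
Local Notation D := nu_doubling_const.

Lemma nu_doubling_const_gt0 : (0 < D)%R.
Proof. by rewrite mulr_gt0// powR_gt0. Qed.

(** Apply the mean bound on B(x, 2r) to the indicator of B(x, r): nu (B(x, 2r))
    times mu(B(x, r))^p0 is at most M mu(B(x, 2r))^p0 nu(B(x, r)). *)
Lemma nu_doubling x r : (0 < r)%R ->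
  nu (ball x (2 * r)%R) <= D%:E * nu (ball x r).
Proof.
move=> r0; have r20 : (0 < 2 * r)%R by rewrite mulr_gt0.
have mB := measurable_metric_ball x r.
have mB2 := measurable_metric_ball x (2 * r)%R.
have B12 : (ball x r : set (borel S)) `<=` ball x (2 * r)%R.
  by apply: subset_ball; rewrite mdistxx add0r; lra.
have := @nu_mean x _ r20 (\1_(ball x r)) (measurable_indic mB) _.
rewrite integral_indic// (setIidl B12).
have -> : \int[nu]_(y in ball x (2 * r)%R) (\1_(ball x r) y `^ p0)%:E = nu (ball x r).
  rewrite -[in RHS](setIidl B12) -integral_indic//; apply: eq_integral => y _.
  by rewrite indicE; case: (y \in _); rewrite ?powR1// powR0.
move=> /(_ (fun=> ler0n _ _)) H.
have [_ mu2 _] := mu_doubling x r0.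
have m0 := mu_ball_gt0 mu_doubling x r0.
have mfin := mu_ball_fin mu_doubling x r.
have mp0 : 0 < mu (ball x r) `^ p0 by rewrite poweR_gt0.
have mpfin : mu (ball x r) `^ p0 \is a fin_num by rewrite fin_num_poweR.
rewrite -(@lee_pmul2r _ (mu (ball x r) `^ p0))//.
apply: (le_trans H); rewrite -muleA [D%:E]EFinM -muleA lee_pmul2l ?lte_fin//.
rewrite [nu _ * _]muleC muleA lee_wpmul2r// -poweR_EFin -poweRM ?lee_fin ?(ltW C_gt0)//.
apply: gt0_ler_poweR => //; first exact: ltW.
  by rewrite in_itv /= leey andbT.
by rewrite in_itv /= leey andbT mule_ge0// lee_fin ltW.
Qed.

Lemma average_poweR_le x r g : (0 < r)%R -> measurable_fun setT (g : borel S -> R) ->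
  (forall y, 0 <= g y)%R ->
  average mu (ball x r) (fun y => (g y)%:E) `^ p0 <=
    M%:E * ((nu (ball x r))^-1 * \int[nu]_(y in ball x r) (g y `^ p0)%:E).
Proof.
move=> r0 mg g0; have := @nu_mean x r r0 g mg g0.
have m0 := mu_ball_gt0 mu_doubling x r0.
have mfin := mu_ball_fin mu_doubling x r.
have n0 := nu_ball_gt0 x r0.
have nfin : nu (ball x r) \is a fin_num by rewrite ge0_fin_numE// nu_ball_lty.
set I := \int[mu]_(y in _) _; set G := \int[nu]_(y in _) _ => H.
have I0 : 0 <= I by apply: integral_ge0 => y _; rewrite lee_fin.
have G0 : 0 <= G by apply: integral_ge0 => y _; rewrite lee_fin powR_ge0.
rewrite /average -/I.
have IE : I = mu (ball x r) * ((mu (ball x r))^-1 * I).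
  by rewrite muleA divee ?mul1e// gt_eqF.
have A0 : 0 <= (mu (ball x r))^-1 * I by rewrite mule_ge0// inve_ge0.
move: H; rewrite {1}IE poweRM// => H.
have mp0 : 0 < mu (ball x r) `^ p0 by rewrite poweR_gt0.
have mpfin : mu (ball x r) `^ p0 \is a fin_num by rewrite fin_num_poweR.
rewrite -(@lee_pmul2l _ (mu (ball x r) `^ p0))//.
rewrite -(@lee_pmul2l _ (nu (ball x r)))//.
apply: (le_trans H).
rewrite [leRHS](_ : _ = (nu (ball x r) * (nu (ball x r))^-1) *
  (M%:E * (mu (ball x r) `^ p0 * G))); last first.
  rewrite -!muleA; congr (_ * _).
  rewrite [RHS]muleCA [X in _ = _ * X]muleCA [RHS]muleCA.
  by congr (_ * _).
by rewrite divee ?mul1e// gt_eqF.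
Qed.

(** By average_poweR_le the left-hand side is at most M times the integral of
    H(x, y) = 1(d(x, y) < r) g(y)^p0 / nu(B(x, r)) in both variables. For fixed
    y, doubling gives nu(B(y, r)) <= D nu(B(x, r)) for all x in B(y, r), so the
    integral in x is at most D g(y)^p0. *)
Lemma averaging_bound r g : (0 < r)%R -> measurable_fun setT (g : borel S -> R) ->
  (forall y, 0 <= g y)%R ->
  \int[nu]_x (average mu (ball (x : S) r) (fun y => (g y)%:E) `^ p0) <=
  (M * D)%:E * \int[nu]_x (g x `^ p0)%:E.
Proof.
move=> r0 mg g0.
pose nu' := sigma_finite_on_balls nu_ball_lty.
pose V : set (borel S * borel S) := [set xy | ball (xy.1 : S) r xy.2].
have mV : measurable V by exact: (measurable_near_pairs mu_doubling r).
pose G (y : borel S) : \bar R := (g y `^ p0)%:E.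
have mG : measurable_fun setT G.
  by apply/measurable_EFinP; exact: (measurableT_comp (measurable_powR _)).
have G0 y : 0 <= G y by rewrite lee_fin powR_ge0.
pose nV (x : borel S) : \bar R := (nu (ball (x : S) r))^-1.
have mnV : measurable_fun setT nV by exact: (measurable_inv_ball mu_doubling r nu_ball_lty).
have nV0 x : 0 <= nV x by rewrite inve_ge0.
pose H (z : borel S * borel S) : \bar R := nV z.1 * G z.2 * (\1_V z)%:E.
have mH : measurable_fun setT H.
  apply: emeasurable_funM; last by apply/measurable_EFinP; exact: measurable_indic.
  apply: emeasurable_funM.
    exact: (measurableT_comp mnV).
  exact: (measurableT_comp mG).
have H0 (z : borel S * borel S) : 0 <= H z by rewrite !mule_ge0// lee_fin.
have rowE (x : borel S) : \int[nu]_y H (x, y) = nV x * \int[nu]_(y in ball (x : S) r) G y.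
  rewrite -ge0_integralZl//; first last.
  - exact: measurable_funTS.
  - exact: measurable_metric_ball.
  rewrite [RHS]integral_mkcond epatch_indic; apply: eq_integral => y _.
  by rewrite /H /= !indicE; congr (_ * _%:R%:E); apply/idP/idP; rewrite !inE.
have colE (y : borel S) : \int[nu]_x H (x, y) <= D%:E * G y.
  have mB := measurable_metric_ball (y : S) r.
  have n0 := nu_ball_gt0 y r0.
  have nfin : nu (ball (y : S) r) \is a fin_num by rewrite ge0_fin_numE// nu_ball_lty.
  pose k : \bar R := D%:E * nV y * G y.
  apply: (@le_trans _ _ (\int[nu]_(x in ball (y : S) r) cst k x)).
    rewrite [leRHS]integral_mkcond epatch_indic.
    apply: ge0_le_integral => //.
    - exact: (measurableT_comp mH (measurable_pair2 y)).
    - apply: emeasurable_funM; first exact: measurable_cst.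
      by apply/measurable_EFinP; exact: measurable_indic.
    move=> x _; rewrite /H /= !indicE.
    have [xy|xy] := pselect (ball (x : S) r y); last first.
      by rewrite memNset// mule0 mule_ge0// /k !mule_ge0// lee_fin ltW// nu_doubling_const_gt0.
    rewrite mem_set// mule1 mem_set; last exact: ball_sym.
    rewrite mule1 /k lee_wpmul2r//.
    have nx0 := nu_ball_gt0 x r0.
    have nxfin : nu (ball (x : S) r) \is a fin_num by rewrite ge0_fin_numE// nu_ball_lty.
    have : nu (ball (y : S) r) <= D%:E * nu (ball (x : S) r).
      apply: le_trans (nu_doubling x r0).
      apply: le_measure; rewrite ?inE; try exact: measurable_metric_ball.
      by apply: subset_ball; move: xy; rewrite ball_mdist; lra.
    rewrite /nV; move: n0 nfin nx0 nxfin.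
    case: (nu (ball (y : S) r)) => // a; case: (nu (ball (x : S) r)) => // b.
    rewrite !lte_fin => a0 _ b0 _; rewrite !inver !gt_eqF// -!EFinM !lee_fin => ab.
    by rewrite ler_pdivlMr// ler_pdivrMl// mulrC.
  rewrite integral_cst// /k -muleA [G y * _]muleC muleA -[_ * nV y * _]muleA.
  by rewrite /nV [X in _ * X * _]muleC divee ?mule1// gt_eqF.
have mA : measurable_fun setT (fun x : borel S =>
    average mu (ball (x : S) r) (fun y => (g y)%:E)).
  apply: (@measurable_ball_average _ _ mu C mu_doubling r (fun xy => (g xy.2)%:E)).
    by apply/measurable_EFinP; exact: (measurableT_comp mg).
  by move=> xy; rewrite lee_fin.
have mF : measurable_fun setT (fun x : borel S => \int[nu]_y H (x, y)).
  exact: (measurable_fun_fubini_tonelli_F (m2 := nu') H mH H0).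
have mFG : measurable_fun setT (fun y : borel S => \int[nu]_x H (x, y)).
  exact: (measurable_fun_fubini_tonelli_G (m1 := nu') H mH H0).
apply: (@le_trans _ _ (\int[nu]_x (M%:E * \int[nu]_y H (x, y)))).
  apply: ge0_le_integral => //.
  - by move=> x _; exact: poweR_ge0.
  - exact: (measurableT_comp (measurable_poweR _) mA).
  - exact: measurable_funeM.
  - by move=> x _; rewrite rowE; exact: average_poweR_le.
rewrite ge0_integralZl//; first last.
- by rewrite lee_fin ltW.
- by move=> x _; exact: integral_ge0.
rewrite EFinM -muleA lee_pmul2l ?lte_fin//.
have -> : \int[nu]_x \int[nu]_y H (x, y) = \int[nu]_y \int[nu]_x H (x, y).
  exact: (@fubini_tonelli _ _ _ _ _ nu' nu' H mH H0).
rewrite -ge0_integralZl//; first last.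
- by rewrite lee_fin ltW// nu_doubling_const_gt0.
- by move=> y _; exact: G0.
apply: ge0_le_integral => //.
- by move=> y _; exact: integral_ge0.
- exact: measurable_funeM.
Qed.

End averaging.

(** * The total oscillation *)

Section total_oscillation.
Context (R : realType) (S : completeMetricType R).
Variables mu nu : {measure set (borel S) -> \bar R}.
Variable C : R.
Hypothesis mu_doubling : doubling_with mu C.
Hypothesis nu_ball_lty : forall (x : S) (r : R), (nu (ball x r) < +oo)%E.
Hypothesis nu_ball_gt0 : forall (x : S) (r : R), 0 < r -> (0 < nu (ball x r))%E.
Variables p p0 M : R.
Hypotheses (p_gt0 : 0 < p) (p0_gt1 : 1 < p0) (M_gt0 : 0 < M).
Hypothesis nu_mean : ball_mean_bound mu nu p0 M.
Implicit Types (x : S) (r : R) (f g : borel S -> R).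
Local Open Scope ereal_scope.
Local Notation modular := (modular nu p).
Local Notation total_osc := (total_osc mu nu p p0).
Local Notation mean_osc := (mean_osc mu p p0).

Let p0_gt0 : (0 < p0)%R := lt_trans ltr01 p0_gt1.
Let p0N0 : (p0 != 0)%R. Proof. by rewrite gt_eqF. Qed.
Let q : R := (p / p0)%R.
Let q_gt0 : (0 < q)%R. Proof. exact: divr_gt0. Qed.
Let qp0 : (q * p0 = p)%R. Proof. by rewrite /q divfK. Qed.

Lemma average_affine_le x r (F G H : borel S -> R) (k : R) :
  (0 <= k)%R -> measurable_fun setT F -> measurable_fun setT G ->
  measurable_fun setT H ->
  (forall y, 0 <= F y)%R -> (forall y, 0 <= G y)%R -> (forall y, 0 <= H y)%R ->
  (forall y, H y <= k * (F y + G y))%R ->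
  average mu (ball x r) (fun y => (H y)%:E) <=
    k%:E * (average mu (ball x r) (fun y => (F y)%:E) +
            average mu (ball x r) (fun y => (G y)%:E)).
Proof.
move=> k0 mF mG mH F0 G0 H0 HFG; have mB := measurable_metric_ball x r.
have mE (A : borel S -> R) : measurable_fun setT A ->
    measurable_fun (ball x r : set (borel S)) (fun y => (A y)%:E).
  by move=> mA; apply: measurable_funTS; exact/measurable_EFinP.
have mFE := mE _ mF; have mGE := mE _ mG; have mHE := mE _ mH.
rewrite /average -ge0_muleDr; last 2 first.
- by apply: integral_ge0 => y _; rewrite lee_fin.
- by apply: integral_ge0 => y _; rewrite lee_fin.
rewrite muleCA lee_wpmul2l ?inve_ge0//.
rewrite -ge0_integralD//; try by move=> y _; rewrite lee_fin.
rewrite -ge0_integralZl//; first last.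
- by move=> y _; rewrite adde_ge0// lee_fin.
- exact: emeasurable_funD.
apply: ge0_le_integral => //.
- by move=> y _; rewrite lee_fin.
- by apply: measurable_funeM; exact: emeasurable_funD.
- by move=> y _; rewrite -EFinD -EFinM lee_fin.
Qed.

Lemma measurable_dist_powR f (a s : R) : measurable_fun setT f ->
  measurable_fun setT (fun y => `|a - f y| `^ s)%R.
Proof.
move=> mf; apply: (measurableT_comp (measurable_powR _)) => //.
by apply: measurableT_comp => //; exact: measurable_funB.
Qed.

Lemma mean_oscD r f g x : measurable_fun setT f -> measurable_fun setT g ->
  mean_osc r (f \+ g)%R x <= (2 `^ q)%:E * (mean_osc r f x + mean_osc r g x).
Proof.
move=> mf mg; apply: average_affine_le; rewrite ?powR_ge0//; try exact: measurable_dist_powR.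
  by apply: measurable_dist_powR; exact: measurable_funD.
move=> y /=; rewrite opprD addrACA; exact: powR_normD (ltW q_gt0).
Qed.

Lemma mean_oscZ r (c : R) f x : measurable_fun setT f ->
  mean_osc r (fun y => c * f y)%R x = (`|c| `^ q)%:E * mean_osc r f x.
Proof.
move=> mf; rewrite /mean_osc /average muleCA; congr (_ * _).
rewrite -ge0_integralZl//.
- by apply: eq_integral => y _; rewrite -mulrBr normrM powRM.
- exact: measurable_metric_ball.
- by apply: measurable_funTS; apply/measurable_EFinP; exact: measurable_dist_powR.
Qed.

Lemma average_cst x r (k : \bar R) : (0 < r)%R -> average mu (ball x r) (cst k) = k.
Proof.
move=> r0; rewrite /average integral_cst; last exact: measurable_metric_ball.
rewrite muleCA muleC [_^-1 * _]muleC divee ?mul1e//.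
- exact: mu_ball_fin mu_doubling x r.
- by rewrite gt_eqF// (mu_ball_gt0 mu_doubling).
Qed.

Lemma mean_osc_le_average r f x : (0 < r)%R -> measurable_fun setT f ->
  mean_osc r f x <= (2 `^ q)%:E *
    ((`|f x| `^ q)%:E + average mu (ball x r) (fun y => (`|f y| `^ q)%:E)).
Proof.
move=> r0 mf; rewrite -[X in _ * (X + _)](average_cst x _ r0).
apply: average_affine_le; rewrite ?powR_ge0//.
- apply: (measurableT_comp (measurable_powR _)) => //.
  exact: measurableT_comp.
- exact: measurable_dist_powR.
- by move=> y; rewrite -[in leRHS](normrN (f y)); exact: powR_normD (ltW q_gt0).
Qed.

Definition osc_const : R := ((2 `^ q) `^ p0 * 2 `^ p0)%R.

Lemma osc_const_gt0 : (0 < osc_const)%R.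
Proof. by rewrite mulr_gt0// powR_gt0// powR_gt0. Qed.

Lemma total_affine_le (F G H : borel S -> \bar R) :
  measurable_fun setT F -> measurable_fun setT G -> measurable_fun setT H ->
  (forall y, 0 <= F y) -> (forall y, 0 <= G y) -> (forall y, 0 <= H y) ->
  (forall y, H y <= (2 `^ q)%:E * (F y + G y)) ->
  \int[nu]_x (H x `^ p0) <=
    osc_const%:E * (\int[nu]_x (F x `^ p0) + \int[nu]_x (G x `^ p0)).
Proof.
move=> mF mG mH F0 G0 H0 HFG.
have mp (A : borel S -> \bar R) : measurable_fun setT A ->
    measurable_fun setT (fun y => A y `^ p0).
  exact: (measurableT_comp (measurable_poweR _)).
have k0 := osc_const_gt0.
rewrite -ge0_integralD//; try exact: mp; try by move=> y _; exact: poweR_ge0.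
rewrite -ge0_integralZl//; first last.
- by rewrite lee_fin ltW.
- by move=> y _; rewrite adde_ge0 ?poweR_ge0.
- by apply: emeasurable_funD; exact: mp.
apply: ge0_le_integral => //.
- by move=> y _; exact: poweR_ge0.
- exact: mp.
- by apply: measurable_funeM; apply: emeasurable_funD; exact: mp.
move=> y _; apply: (@le_trans _ _ (((2 `^ q)%:E * (F y + G y)) `^ p0)).
  apply: gt0_ler_poweR => //; first exact: ltW.
  - by rewrite in_itv /= leey andbT.
  - by rewrite in_itv /= leey andbT mule_ge0 ?adde_ge0// lee_fin powR_ge0.
rewrite poweRM ?lee_fin ?powR_ge0 ?adde_ge0//.
rewrite poweR_EFin /osc_const EFinM -muleA lee_wpmul2l ?lee_fin ?powR_ge0//.
by apply: poweRD_le => //; exact: ltW.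
Qed.

(** With total_osc_le_modular, this makes the total oscillation stable under
    perturbations that are small in the modular. *)
Lemma total_oscD r f g : measurable_fun setT f -> measurable_fun setT g ->
  total_osc r (f \+ g)%R <= osc_const%:E * (total_osc r f + total_osc r g).
Proof.
move=> mf mg; apply: total_affine_le; try exact: measurable_mean_osc;
  try by move=> y; exact: mean_osc_ge0.
- exact: (measurable_mean_osc mu_doubling).
- exact: (measurable_mean_osc mu_doubling).
- by apply: (measurable_mean_osc mu_doubling); exact: measurable_funD.
- by move=> y; exact: mean_oscD.
Qed.

Lemma total_oscZ r (c : R) f : measurable_fun setT f ->
  total_osc r (fun y => c * f y)%R = (`|c| `^ p)%:E * total_osc r f.
Proof.
move=> mf; rewrite /total_osc -ge0_integralZl//.
- apply: eq_integral => x _; rewrite mean_oscZ// poweRM ?mean_osc_ge0//.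
  by rewrite poweR_EFin -powRrM qp0.
- exact: (measurable_mean_osc_poweR mu_doubling).
- by move=> y _; exact: poweR_ge0.
Qed.

Definition modular_const : R := (osc_const * (1 + M * nu_doubling_const C p0 M))%R.

Lemma modular_const_gt0 : (0 < modular_const)%R.
Proof.
have C0 := doubling_const_gt0 mu_doubling.
rewrite mulr_gt0 ?osc_const_gt0// ltr_wpDr// mulr_ge0 ?(ltW M_gt0)//.
by rewrite mulr_ge0 ?(ltW M_gt0)// powR_ge0.
Qed.

(** mean_osc r f x is at most a constant times |f x|^q plus the average of
    |f|^q over B(x, r); as q p0 = p, the p0-th power of the first term
    integrates to the modular, and averaging_bound controls the second. *)
Lemma total_osc_le_modular r f : (0 < r)%R -> measurable_fun setT f ->
  total_osc r f <= modular_const%:E * modular f.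
Proof.
move=> r0 mf.
have mfq : measurable_fun setT (fun y => `|f y| `^ q)%R.
  by apply: (measurableT_comp (measurable_powR _)) => //; exact: measurableT_comp.
have fq0 y : (0 <= `|f y| `^ q)%R by exact: powR_ge0.
have mA : measurable_fun setT (fun x : borel S =>
    average mu (ball (x : S) r) (fun y => (`|f y| `^ q)%:E)).
  apply: (@measurable_ball_average _ _ mu C mu_doubling r (fun xy => (`|f xy.2| `^ q)%:E)) => //.
  by apply/measurable_EFinP; exact: (measurableT_comp mfq measurable_snd).
have fE : \int[nu]_x ((`|f x| `^ q)%:E `^ p0) = modular f.
  by apply: eq_integral => x _; rewrite poweR_EFin -powRrM qp0.
have fE' : \int[nu]_x (((`|f x| `^ q) `^ p0)%:E) = modular f.
  by apply: eq_integral => x _; rewrite -powRrM qp0.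
have H : total_osc r f <= osc_const%:E * (modular f +
    \int[nu]_x (average mu (ball (x : S) r) (fun y => (`|f y| `^ q)%:E) `^ p0)).
  pose F (x : borel S) : \bar R := (`|f x| `^ q)%:E.
  pose G (x : borel S) := average mu (ball (x : S) r) (fun y => (`|f y| `^ q)%:E).
  have := @total_affine_le F G (mean_osc r f : borel S -> \bar R).
  rewrite fE; apply.
  - exact/measurable_EFinP.
  - exact: mA.
  - exact: (measurable_mean_osc mu_doubling).
  - by move=> x; rewrite lee_fin.
  - move=> x; apply: mule_ge0; first by rewrite inve_ge0.
    by apply: integral_ge0 => y _; rewrite lee_fin.
  - by move=> x; exact: mean_osc_ge0.
  - by move=> x; exact: mean_osc_le_average.
have MD0 : (0 <= M * nu_doubling_const C p0 M)%R.
  apply: mulr_ge0; first exact: ltW.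
  by apply: mulr_ge0; [exact: ltW|exact: powR_ge0].
apply: (le_trans H); rewrite (EFinM osc_const) -muleA.
apply: lee_wpmul2l; first by rewrite lee_fin; exact/ltW/osc_const_gt0.
rewrite EFinD ge0_muleDl; [|by rewrite lee_fin|by rewrite lee_fin].
rewrite mul1e; apply: leeD2l; rewrite -[X in _ <= _ * X]fE'.
exact: (averaging_bound mu_doubling nu_ball_lty nu_ball_gt0 p0_gt1 M_gt0 nu_mean r0 mfq fq0).
Qed.

End total_oscillation.

(** * Functions with vanishing oscillation *)

(** Dominated convergence, with |2 g|^p dominating the |f - f_n|^p. *)
Lemma modular_dominated d (T : measurableType d) (R : realType)
    (nu : {measure set T -> \bar R}) (p : R) (f_ : (T -> R)^nat) (f g : T -> R) :
  0 < p -> (forall n, measurable_fun setT (f_ n)) -> measurable_fun setT f ->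
  measurable_fun setT g -> (forall x, f_ ^~ x @ \oo --> f x) ->
  (forall n x, `|f_ n x| <= `|g x|) -> (modular nu p g < +oo)%E ->
  forall e : R, 0 < e -> exists n, (modular nu p (f \- f_ n)%R <= e%:E)%E.
Proof.
move=> p0 mf_ mf mg f_f f_g gy e e0.
have f_le x : `|f x| <= `|g x|.
  have fc : (fun n => `|f_ n x|) @ \oo --> `|f x| by apply: cvg_norm; exact: f_f.
  rewrite -(cvg_lim _ fc)//; apply: limr_le; first by apply/cvg_ex; exists `|f x|.
  by near=> n; exact: f_g.
pose F n x := (`|f x - f_ n x| `^ p)%:E.
pose G x := (`|2 * g x| `^ p)%:E.
have m2g : measurable_fun setT (fun x => 2 * g x) by exact: measurable_funM.
have mF n : measurable_fun setT (F n).
  by apply: (measurable_norm_powR p (f := (f \- f_ n)%R)); exact: measurable_funB.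
have iG : nu.-integrable setT G.
  apply/integrableP; split; first exact: (measurable_norm_powR p m2g).
  under eq_integral do rewrite gee0_abs ?lee_fin ?powR_ge0//.
  rewrite -/(modular nu p (fun x => 2 * g x)) modularZ//.
  by rewrite lte_mul_pinfty ?lee_fin ?powR_ge0.
have Fc x : F ^~ x @ \oo --> (0 : \bar R)%E.
  apply/cvg_EFin; first by near=> n.
  apply: (@cvg_comp _ _ _ (fun n => f x - f_ n x) (fun t : R => `|t| `^ p) _ (nbhs (0 : R))).
    by rewrite -(subrr (f x)); apply: cvgB; [exact: cvg_cst|exact: f_f].
  have := @continuous_norm_powR R p p0 0.
  by rewrite /continuous_at normr0 powR0// gt_eqF.
have FG n x : (`|F n x| <= G x)%E.
  rewrite gee0_abs ?lee_fin ?powR_ge0// ge0_ler_powR ?nnegrE ?(ltW p0)//.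
  rewrite (le_trans (ler_normB _ _))// normrM ger0_norm// mulr_natl mulr2n.
  exact: lerD.
have [_ _] := @dominated_convergence _ _ _ nu _ measurableT F (cst 0%E) G mF
  (measurable_cst _) (aeW _ (fun x _ => Fc x)) iG (aeW _ (fun x n _ => FG n x)).
rewrite integral0 => /fine_cvgP[Ffin /cvgrPdist_le/(_ _ e0) Fe].
have [n [Fn ne]] := filter_ex (filterI Ffin Fe).
exists n; rewrite -[leLHS]fineK// lee_fin.
have : `|fine (modular nu p (f \- f_ n)%R)| <= e by move: ne; rewrite /= sub0r normrN.
exact: le_trans (ler_norm _).
Unshelve. all: by end_near. Qed.

Section vanishing_oscillation.
Context (R : realType) (S : completeMetricType R).
Variables mu nu : {measure set (borel S) -> \bar R}.
Variable C : R.
Hypothesis mu_doubling : doubling_with mu C.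
Hypothesis nu_ball_lty : forall (x : S) (r : R), (nu (ball x r) < +oo)%E.
Hypothesis nu_ball_gt0 : forall (x : S) (r : R), 0 < r -> (0 < nu (ball x r))%E.
Variables p p0 M : R.
Hypotheses (p_gt0 : 0 < p) (p0_gt1 : 1 < p0) (M_gt0 : 0 < M).
Hypothesis nu_mean : ball_mean_bound mu nu p0 M.
Implicit Types (x : S) (r : R) (f g : borel S -> R).
Local Open Scope ereal_scope.
Local Notation modular := (modular nu p).
Local Notation total_osc := (total_osc mu nu p p0).

Let Co := osc_const p p0.
Let Co_gt0 : (0 < Co)%R := osc_const_gt0 p p0.
Let Cm := modular_const C p p0 M.
Let Cm_gt0 : (0 < Cm)%R := modular_const_gt0 mu_doubling p p0 M_gt0.

Definition vanishing f := forall e : R, (0 < e)%R -> exists2 d : R, (0 < d)%R &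
  forall r, (0 < r < d)%R -> total_osc r f <= e%:E.

Lemma vanishingD f g : measurable_fun setT f -> measurable_fun setT g ->
  vanishing f -> vanishing g -> vanishing (f \+ g)%R.
Proof.
move=> mf mg vf vg e e0.
pose h : R := (e / (Co * 2))%R.
have h0 : (0 < h)%R by rewrite divr_gt0// mulr_gt0.
have [d1 d10 H1] := vf _ h0; have [d2 d20 H2] := vg _ h0.
exists (Num.min d1 d2); first by rewrite lt_min d10.
move=> r /andP[r0]; rewrite lt_min => /andP[r1 r2].
apply: (le_trans (total_oscD nu mu_doubling p_gt0 p0_gt1 r mf mg)).
apply: (@le_trans _ _ (Co%:E * (h%:E + h%:E))).
  rewrite lee_pmul2l ?lte_fin//; apply: leeD.
    by apply: H1; rewrite r0.
  by apply: H2; rewrite r0.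
change ((Co * (h + h))%:E <= e%:E); rewrite lee_fin.
rewrite (_ : _ * _ = e)%R// /h; field.
by rewrite gt_eqF.
Qed.

Lemma vanishingZ (c : R) f : measurable_fun setT f -> vanishing f ->
  vanishing (fun x => c * f x)%R.
Proof.
move=> mf vf e e0.
have c0 : (0 < `|c| `^ p + 1)%R by rewrite ltr_wpDl// powR_ge0.
have [d d0 H] := vf _ (divr_gt0 e0 c0); exists d => // r rd.
rewrite (total_oscZ nu mu_doubling p p0_gt1 r c mf).
apply: (@le_trans _ _ ((`|c| `^ p)%:E * (e / (`|c| `^ p + 1))%:E)).
  by rewrite lee_wpmul2l ?lee_fin ?powR_ge0//; exact: H.
rewrite -EFinM lee_fin mulrCA ler_piMr ?(ltW e0)//.
by rewrite ler_pdivrMr// mul1r lerDl.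
Qed.

Lemma vanishing0 : vanishing (cst 0%R).
Proof.
move=> e e0; exists 1%R => // r /andP[r0 _].
apply: (le_trans (total_osc_le_modular mu_doubling nu_ball_lty nu_ball_gt0 p_gt0
  p0_gt1 M_gt0 nu_mean r0 (measurable_cst _))).
by rewrite modular0// mule0 lee_fin ltW.
Qed.

Lemma vanishing_sum n (c : 'I_n -> R) (h : 'I_n -> borel S -> R) :
  (forall i, measurable_fun setT (h i)) -> (forall i, vanishing (h i)) ->
  vanishing (fun x => \sum_i c i * h i x)%R.
Proof.
elim: n c h => [|n IH] c h mh vh.
  rewrite (_ : (fun x => _) = cst 0%R); first exact: vanishing0.
  by apply/funext => x; rewrite big_ord0.
rewrite (_ : (fun x => _) = (fun x => c ord0 * h ord0 x) \+
    (fun x => \sum_i c (lift ord0 i) * h (lift ord0 i) x))%R; last first.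
  by apply/funext => x; rewrite big_ord_recl.
apply: vanishingD.
- by apply: measurable_funM => //; exact: measurable_cst.
- apply: measurable_sum => i; apply: measurable_funM => //; exact: measurable_cst.
- exact: vanishingZ.
- by apply: (IH (fun i => c (lift ord0 i)) (fun i => h (lift ord0 i))).
Qed.

(** The bound of total_osc_le_modular on the error f - g does not depend on
    r. *)
Lemma vanishing_limit f : measurable_fun setT f ->
  (forall e : R, (0 < e)%R -> exists g, [/\ measurable_fun setT g, vanishing g &
     modular (f \- g)%R <= e%:E]) -> vanishing f.
Proof.
move=> mf fg e e0.
pose h : R := (e / (Co * 2))%R.
have h0 : (0 < h)%R by rewrite divr_gt0// mulr_gt0.
have [g [mg vg gfe]] := fg _ (divr_gt0 h0 Cm_gt0).
have [d d0 H] := vg _ h0; exists d => // r rd.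
have r0 : (0 < r)%R by case/andP: rd.
have mfg : measurable_fun setT (f \- g)%R by exact: measurable_funB.
have fE : f = ((f \- g) \+ g)%R by apply/funext => x /=; rewrite subrK.
rewrite {1}fE; apply: (le_trans (total_oscD nu mu_doubling p_gt0 p0_gt1 r mfg mg)).
apply: (@le_trans _ _ (Co%:E * (h%:E + h%:E))).
  rewrite lee_pmul2l ?lte_fin//; apply: leeD; last exact: H.
  apply: (le_trans (total_osc_le_modular mu_doubling nu_ball_lty nu_ball_gt0 p_gt0
    p0_gt1 M_gt0 nu_mean r0 mfg)).
  apply: (@le_trans _ _ (Cm%:E * (h / Cm)%:E)).
    by rewrite lee_pmul2l ?lte_fin.
  by rewrite -EFinM lee_fin mulrCA divff ?mulr1// gt_eqF.
change ((Co * (h + h))%:E <= e%:E); rewrite lee_fin.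
rewrite (_ : _ * _ = e)%R// /h; field.
by rewrite gt_eqF.
Qed.

Lemma vanishing_dominated (f_ : (borel S -> R)^nat) f g :
  (forall n, measurable_fun setT (f_ n)) -> measurable_fun setT f ->
  measurable_fun setT g -> (forall x, f_ ^~ x @ \oo --> f x) ->
  (forall n x, `|f_ n x| <= `|g x|)%R -> modular g < +oo ->
  (forall n, vanishing (f_ n)) -> vanishing f.
Proof.
move=> mf_ mf mg f_f f_g gy vf; apply: vanishing_limit => // e e0.
have [n fn] := modular_dominated p_gt0 mf_ mf mg f_f f_g gy e0.
by exists (f_ n).
Qed.

End vanishing_oscillation.

Section lipschitz_functions.
Context (R : realType) (S : completeMetricType R).
Implicit Types (x y z : S) (U : set S) (n : nat).

Lemma lipschitz_continuous (f : S -> R) (L : R) : 0 <= L ->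
  (forall y z, `|f y - f z| <= L * mdist y z) -> continuous f.
Proof.
move=> L0 fL y; apply/cvgrPdist_lt => e e0.
apply/nbhs_ballP; exists (e / (L + 1)) => /=; first by rewrite divr_gt0// ltr_wpDl.
move=> z; rewrite ball_mdist ltr_pdivlMr ?ltr_wpDl// => yz.
apply: (le_lt_trans (fL _ _)); apply: le_lt_trans yz.
by rewrite mulrC ler_wpM2l ?mdist_ge0// lerDl.
Qed.

Lemma continuous_measurable_borel (f : S -> R) : continuous f ->
  measurable_fun setT (f : borel S -> R).
Proof.
move=> /continuousP cf; apply: (measurability _ (RGenOpens.measurableE R)).
move=> _ [_ [a [b ->]] <-]; rewrite setTI.
by apply: measurable_open_set; apply: cf; exact: interval_open.
Qed.

(** The function min(1, n d(x, complement of U)), written as one infimum so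
    that it also makes sense when the complement is empty. *)
Definition lipschitz_indic U n x : R :=
  inf ([set 1] `|` [set n%:R * mdist x y | y in ~` U]).

Let lower_bound U n x : lbound ([set 1] `|` [set n%:R * mdist x y | y in ~` U]) 0.
Proof.
by move=> _ [->|[y _ <-]]; rewrite ?ler01// mulr_ge0 ?mdist_ge0 ?ler0n.
Qed.

Lemma lipschitz_indic_ge0 U n x : 0 <= lipschitz_indic U n x.
Proof. by apply: lb_le_inf; [exists 1; left|exact: lower_bound]. Qed.

Lemma lipschitz_indic_le U n x t :
  ([set 1] `|` [set n%:R * mdist x y | y in ~` U]) t -> lipschitz_indic U n x <= t.
Proof. by apply: ge_inf; exists 0; exact: lower_bound. Qed.

Lemma lipschitz_indic_out U n x : ~ U x -> lipschitz_indic U n x = 0.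
Proof.
move=> Ux; apply/eqP; rewrite eq_le lipschitz_indic_ge0 andbT.
by apply: lipschitz_indic_le; right; exists x => //; rewrite mdistxx mulr0.
Qed.

Lemma lipschitz_indic_lipschitz U n y z :
  `|lipschitz_indic U n y - lipschitz_indic U n z| <= n%:R * mdist y z.
Proof.
wlog suff H : y z / lipschitz_indic U n y <= lipschitz_indic U n z + n%:R * mdist y z.
  by rewrite ler_norml lerBlDl H lerNl opprB lerBlDl metric_sym H.
rewrite -lerBlDr; apply: lb_le_inf; first by exists 1; left.
move=> t [->|[u Uu <-]]; rewrite lerBlDr.
  apply: (@le_trans _ _ 1); first by apply: lipschitz_indic_le; left.
  by rewrite lerDl mulr_ge0 ?mdist_ge0.
apply: (@le_trans _ _ (n%:R * mdist y u)).
  by apply: lipschitz_indic_le; right; exists u.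
by rewrite -mulrDr ler_wpM2l// addrC metric_triangle.
Qed.

Lemma lipschitz_indic_cvg U x : open U ->
  lipschitz_indic U ^~ x @ \oo --> (\1_U x : R).
Proof.
move=> oU; apply: cvg_near_cst; rewrite indicE.
have [Ux|Ux] := pselect (U x); last first.
  by near=> n; rewrite memNset//; exact: lipschitz_indic_out.
have /nbhs_ballP[e /= e0 eU] : nbhs x U by exact: open_nbhs_nbhs.
exists (Num.trunc e^-1).+1 => // n /= ne; rewrite mem_set//=.
apply/eqP; rewrite eq_le lipschitz_indic_le/=; last by left.
apply: lb_le_inf; first by exists 1; left.
move=> _ [->//|[y Uy <-]].
have ey : e <= mdist x y.
  by rewrite leNgt; apply/negP => xy; apply: Uy; apply: eU; rewrite ball_mdist.
apply: (@le_trans _ _ (n%:R * e)); last by rewrite ler_wpM2l.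
rewrite -ler_pdivrMr// div1r ltW// (lt_le_trans (truncnS_gt _))//.
by rewrite ler_nat.
Unshelve. all: by end_near. Qed.

End lipschitz_functions.

Section dense_class.
Context (R : realType) (S : completeMetricType R).
Variables mu nu : {measure set (borel S) -> \bar R}.
Variable C : R.
Hypothesis mu_doubling : doubling_with mu C.
Hypothesis nu_ball_lty : forall (x : S) (r : R), (nu (ball x r) < +oo)%E.
Hypothesis nu_ball_gt0 : forall (x : S) (r : R), 0 < r -> (0 < nu (ball x r))%E.
Variables p p0 M : R.
Hypotheses (p_gt0 : 0 < p) (p0_gt1 : 1 < p0) (M_gt0 : 0 < M).
Hypothesis nu_mean : ball_mean_bound mu nu p0 M.
Implicit Types (x : S) (r : R) (f g : borel S -> R).
Local Open Scope ereal_scope.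
Local Notation modular := (modular nu p).
Local Notation mean_osc := (mean_osc mu p p0).

Let p0_gt0 : (0 < p0)%R := lt_trans ltr01 p0_gt1.
Let p0N0 : (p0 != 0)%R. Proof. by rewrite gt_eqF. Qed.
Let q : R := (p / p0)%R.
Let q_gt0 : (0 < q)%R. Proof. exact: divr_gt0. Qed.
Let qp0 : (q * p0 = p)%R. Proof. by rewrite /q divfK. Qed.

Local Notation vanishing := (vanishing mu nu p p0).

Lemma mean_osc_le_cst r f y (b : R) : (0 < r)%R -> (0 <= b)%R ->
  measurable_fun setT f -> (forall z : S, ball (y : S) r z -> `|f y - f z| <= b)%R ->
  mean_osc r f y <= (b `^ q)%:E.
Proof.
move=> r0 b0 mf fb; rewrite -[leRHS](average_cst mu_doubling y _ r0).
rewrite /mean_osc /average lee_wpmul2l ?inve_ge0//.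
have mB := measurable_metric_ball (y : S) r.
apply: ge0_le_integral => //.
- by apply: measurable_funTS; apply/measurable_EFinP; exact: measurable_dist_powR.
- by move=> z yz; rewrite lee_fin ge0_ler_powR ?nnegrE ?(ltW q_gt0)//; exact: fb.
Qed.

(** For r <= 1 the mean oscillation is supported in B(x, A + 1), a set of
    finite measure, and is bounded there by (L r)^q. *)
Lemma lipschitz_vanishing f (x : S) (A L : R) : (0 <= L)%R -> measurable_fun setT f ->
  (forall y z : S, `|f y - f z| <= L * mdist y z)%R ->
  (forall y, ~ ball x A y -> f y = 0%R) -> vanishing f.
Proof.
move=> L0 mf fL fA e e0.
pose N : R := fine (nu (ball x (A + 1)%R)).
have NE : nu (ball x (A + 1)%R) = N%:E by rewrite fineK// ge0_fin_numE ?nu_ball_lty.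
have N0 : (0 <= N)%R by rewrite fine_ge0.
have eN : (0 < e / (N + 1))%R by rewrite divr_gt0// ltr_wpDl.
(* b^p N <= e *)
pose b : R := ((e / (N + 1)) `^ p^-1)%R.
have b0 : (0 < b)%R by rewrite powR_gt0.
exists (Num.min 1 (b / (L + 1)))%R.
  by rewrite lt_min ltr01 divr_gt0// ltr_wpDl.
move=> r /andP[r0]; rewrite lt_min => /andP[r1].
rewrite ltr_pdivlMr ?ltr_wpDl// => rb.
have Lrb : (L * r <= b)%R by nra.
have mB := measurable_metric_ball x (A + 1)%R.
have powle (a : \bar R) (c : R) : (0 <= c)%R -> 0 <= a -> a <= (c `^ q)%:E ->
    a `^ p0 <= (c `^ p)%:E.
  move=> c0 a0 ac; rewrite -qp0 powRrM -poweR_EFin.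
  apply: gt0_ler_poweR ac; first exact: ltW.
  - by rewrite in_itv /= leey andbT.
  - by rewrite in_itv /= leey andbT lee_fin powR_ge0.
have inside (y : S) : mean_osc r f y <= (b `^ q)%:E.
  apply: (mean_osc_le_cst r0 (ltW b0) mf) => z yz.
  apply: (le_trans (fL _ _)); apply: le_trans Lrb.
  by rewrite ler_wpM2l// ltW// -ball_mdist.
have outside (y : S) : ~ ball x (A + 1)%R y -> mean_osc r f y <= (0 `^ q)%:E.
  move=> xy.
  have xyA : (A + 1 <= mdist x y)%R by rewrite leNgt; apply/negP; rewrite -ball_mdist.
  apply: (mean_osc_le_cst r0 (lexx 0%R) mf) => z; rewrite ball_mdist => yz.
  rewrite !fA ?subrr ?normr0//; rewrite ball_mdist; apply/negP; rewrite -leNgt.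
    have := metric_triangle x z y; rewrite (metric_sym z) => ?.
    by lra.
  by lra.
have key (y : S) : mean_osc r f y `^ p0 <=
    (b `^ p)%:E * (\1_(ball x (A + 1)%R : set (borel S)) y)%:E.
  rewrite indicE; have [xy|xy] := pselect (ball x (A + 1)%R y).
    rewrite (mem_set xy) mule1.
    exact: powle (ltW b0) (mean_osc_ge0 _ _ _ _ _ _) (inside y).
  rewrite (memNset xy) mule0.
  have := powle _ 0%R (lexx _) (mean_osc_ge0 _ _ _ _ _ _) (outside y xy).
  by rewrite (powR0 (lt0r_neq0 p_gt0)).
apply: (@le_trans _ _ (\int[nu]_y ((b `^ p)%:E * (\1_(ball x (A + 1)%R) y)%:E))).
  apply: (ge0_le_integral nu measurableT).
  - by move=> y _; exact: poweR_ge0.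
  - exact: (measurable_mean_osc_poweR mu_doubling).
  - by apply: measurable_funeM; apply/measurable_EFinP; exact: measurable_indic.
  - by move=> y _; exact: key.
rewrite ge0_integralZl ?lee_fin ?powR_ge0//; last first.
  by apply/measurable_EFinP; exact: measurable_indic.
rewrite integral_indic// setIT NE -EFinM lee_fin /b -powRrM mulVf ?gt_eqF//.
rewrite powRr1 ?(ltW eN)// mulrAC ler_pdivrMr ?ltr_wpDl//.
by rewrite ler_wpM2l ?(ltW e0)// lerDl.
Qed.

(** The indicator of an open set is the increasing limit of the Lipschitz
    functions min(1, n d(x, complement of U)). *)
Lemma open_vanishing (U : set S) (x : S) (A : R) : open U -> U `<=` ball x A ->
  vanishing \1_U.
Proof.
move=> oU UA.
have mU : measurable (U : set (borel S)) by exact: measurable_open_set.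
have mphi n : measurable_fun setT (lipschitz_indic U n : borel S -> R).
  apply: continuous_measurable_borel.
  apply: (@lipschitz_continuous _ _ _ n%:R) => //; exact: lipschitz_indic_lipschitz.
apply: (@vanishing_dominated _ _ mu nu C mu_doubling nu_ball_lty nu_ball_gt0 p p0 M
  p_gt0 p0_gt1 M_gt0 nu_mean (lipschitz_indic U) \1_U \1_U) => //.
- by move=> y; exact: lipschitz_indic_cvg.
- move=> n y; rewrite ger0_norm ?lipschitz_indic_ge0// indicE.
  have [Uy|Uy] := pselect (U y); last by rewrite lipschitz_indic_out// normr0 memNset.
  by rewrite mem_set// normr1; apply: lipschitz_indic_le; left.
- rewrite (_ : \1_U = fun y => 1 * \1_U y)%R; last first.
    by apply/funext => y; rewrite mul1r.
  rewrite modular_indic// normr1 powR1 mul1e.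
  apply: le_lt_trans (nu_ball_lty x A).
  by apply: le_measure; rewrite ?inE//; exact: measurable_metric_ball.
- move=> n; apply: (@lipschitz_vanishing _ x A n%:R) => //.
    exact: lipschitz_indic_lipschitz.
  by move=> y xy; apply: lipschitz_indic_out => /UA.
Qed.

(** Dynkin's theorem: the sets E for which the conclusion holds contain the
    open sets and are closed under complement and countable disjoint union.
    Intersecting with a ball keeps all indicators in L^p(w). *)
Lemma borel_vanishing (x : S) (A : R) (E : set (borel S)) : measurable E ->
  vanishing \1_(E `&` ball x A).
Proof.
have mV : measurable (ball x A : set (borel S)) by exact: measurable_metric_ball.
have oV := open_metric_ball x A.
have vV : vanishing \1_(ball x A) by exact: (@open_vanishing _ x A).
have modV : modular \1_(ball x A) < +oo.
  rewrite (_ : \1_(ball x A) = fun y => 1 * \1_(ball x A) y)%R; last first.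
    by apply/funext => y; rewrite mul1r.
  by rewrite modular_indic// normr1 powR1 mul1e nu_ball_lty.
pose Q : set_system (borel S) := fun E => vanishing \1_(E `&` ball x A).
have openI' : setI_closed (@open S) by move=> U V oU oV'; exact: openI.
have QT : Q setT by rewrite /Q setTI.
have Qopen : @open S `<=` Q.
  by move=> U oU; apply: (@open_vanishing _ x A); [exact: openI|move=> y []].
have QC F : measurable F -> Q F -> Q (~` F).
  move=> mF vF; rewrite /Q.
  (* relative to the ball, the indicator of the complement is a difference *)
  have -> : (\1_(~` F `&` ball x A) : borel S -> R) =
      ((\1_(ball x A) : borel S -> R) \+
       (fun y : borel S => (-1 : R) * \1_(F `&` ball x A) y))%R.
    apply/funext => y /=; rewrite !indicE !in_setI in_setC.
    by case: (y \in F); case: (y \in (ball x A : set (borel S))); rewrite /= ?mulr0 ?addr0 ?mulr1 ?subrr.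
  have mFV : measurable (F `&` ball x A : set (borel S)) by exact: measurableI.
  have mI : measurable_fun setT (\1_(F `&` ball x A) : borel S -> R).
    exact: measurable_indic.
  have mI' : measurable_fun setT (fun y : borel S => (-1 : R) * \1_(F `&` ball x A) y)%R.
    by apply: measurable_funM => //; exact: measurable_cst.
  apply: (vanishingD mu_doubling p_gt0 p0_gt1 _ mI' vV).
    exact: measurable_indic.
  exact: (vanishingZ mu_doubling p0_gt1 (-1)%R mI vF).
have QU (F : (set (borel S))^nat) : (forall n, measurable (F n)) ->
    trivIset [set: nat] F -> (forall n, Q (F n)) -> Q (\bigcup_k F k).
  move=> mF tF vF; rewrite /Q.
  pose P k : set (borel S) := F k `&` ball x A.
  have mP k : measurable (P k) by exact: measurableI.
  have tP : trivIset [set: nat] P by exact: trivIset_setIr.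
  pose f_ n (y : borel S) : R := (\sum_(i < n) 1 * \1_(P i) y)%R.
  have mI i : measurable_fun setT (\1_(P i) : borel S -> R).
    exact: measurable_indic.
  have mf_ n : measurable_fun setT (f_ n).
    apply: measurable_sum => i; apply: measurable_funM; last exact: mI.
    exact: measurable_cst.
  have mUF : measurable_fun setT (\1_(\bigcup_k F k `&` ball x A) : borel S -> R).
    apply: measurable_indic; apply: measurableI => //.
    exact: bigcupT_measurable.
  have mIV : measurable_fun setT (\1_(ball x A) : borel S -> R).
    exact: measurable_indic.
  apply: (vanishing_dominated mu_doubling nu_ball_lty nu_ball_gt0
    p_gt0 p0_gt1 M_gt0 nu_mean mf_ mUF mIV _ _ modV).
  - move=> y; apply: cvg_near_cst; rewrite indicE.
    have [[[k _ Fk] xy]|Ny] := pselect ((\bigcup_k F k `&` ball x A) y).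
      exists k.+1 => // n /= kn.
      rewrite mem_set; last by split => //; exists k.
      by apply: (sum_cells tP (fun=> 1%R) (j := Ordinal kn)); split.
    exists 0%N => // n _ /=; rewrite memNset//.
    apply: (sum_cells0 (fun=> 1%R)) => j [Fj xy].
    by apply: Ny; split => //; exists (val j).
  - move=> n y; rewrite /f_.
    have [[j Pj]|NP] := pselect (exists j : 'I_n, P j y).
      have /= -> := sum_cells tP (fun=> 1%R) Pj.
      by case: Pj => _ xy; rewrite indicE mem_set.
    have NP' (j : 'I_n) : ~ P j y by move=> Pj; apply: NP; exists j.
    by have /= -> := sum_cells0 (fun=> 1%R) NP'; rewrite normr0.
  - move=> n; apply: (vanishing_sum mu_doubling nu_ball_lty nu_ball_gt0 p_gt0
      p0_gt1 M_gt0 nu_mean (fun=> 1%R)) => i; first exact: mI.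
    exact: vF.
exact: (@dynkin_induction _ (borel S) (@open S) Q erefl openI' QT Qopen QC QU).
Unshelve. all: by end_near. Qed.

(** Simple functions increasing to f, each cut off to the ball of radius n,
    converge to f and are dominated by f. *)
Lemma ge0_vanishing f : measurable_fun setT f -> (forall y, 0 <= f y)%R ->
  modular f < +oo -> vanishing f.
Proof.
move=> mf f0 fy.
have mfE : measurable_fun setT (EFin \o f) by exact/measurable_EFinP.
pose h := nnsfun_approx measurableT mfE.
pose f_ n (y : borel S) : R := (h n y * \1_(ball (point : S) n%:R) y)%R.
have mh n : measurable_fun setT (h n) by [].
have h_f y : (fun n => h n y) @ \oo --> f y.
  have /fine_cvg : (fun n => (h n y)%:E) @ \oo --> (f y)%:E.
    by apply: cvg_nnsfun_approx => // z _; rewrite lee_fin.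
  by [].
apply: (@vanishing_dominated _ _ mu nu C mu_doubling nu_ball_lty nu_ball_gt0 p p0 M
  p_gt0 p0_gt1 M_gt0 nu_mean f_ f f) => //.
- move=> n; apply: measurable_funM => //; apply: measurable_indic.
  exact: measurable_metric_ball.
- move=> y; rewrite -[X in _ --> X]mulr1; apply: cvgM.
    exact: h_f.
  apply: cvg_near_cst.
  exists (Num.trunc (mdist (point : S) y)).+1 => // n /= kn.
  rewrite indicE mem_set// ball_mdist (lt_le_trans (truncnS_gt _))//.
  by rewrite ler_nat.
- move=> n y; rewrite /f_ ger0_norm ?mulr_ge0//.
  rewrite ger0_norm//.
  apply: (@le_trans _ _ (h n y)).
    by rewrite indicE; case: (y \in _); rewrite ?mulr1 ?mulr0.
  rewrite -(cvg_lim (@Rhausdorff R) (h_f y)); apply: nondecreasing_cvgn_le.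
    by move=> a b ab; have /lefP := nd_nnsfun_approx measurableT mfE ab; apply.
  by apply/cvg_ex; exists (f y); exact: h_f.
move=> n; have [k [a [A [a0 mA hA]]]] := nnsfun_sum_indic (h n).
rewrite (_ : f_ n = fun y => \sum_i a i * \1_(A i `&` ball (point : S) n%:R) y)%R.
  apply: (vanishing_sum mu_doubling nu_ball_lty nu_ball_gt0 p_gt0 p0_gt1 M_gt0 nu_mean a) => i.
    by apply: measurable_indic; apply: measurableI => //; exact: measurable_metric_ball.
  exact: borel_vanishing.
apply/funext => y; rewrite /f_ hA mulr_suml; apply: eq_bigr => i _.
by rewrite -mulrA indicI.
Qed.

Lemma finite_modular_vanishing f : measurable_fun setT f -> modular f < +oo ->
  vanishing f.
Proof.
move=> mf fy.
pose fp (y : borel S) : R := Num.max (f y) 0%R.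
pose fn (y : borel S) : R := Num.max (- f y)%R 0%R.
have mfp : measurable_fun setT fp by exact: measurable_maxr.
have mfn : measurable_fun setT fn.
  by apply: measurable_maxr => //; exact: measurableT_comp.
have H (g : borel S -> R) : measurable_fun setT g -> (forall y, 0 <= g y <= `|f y|)%R ->
    vanishing g.
  move=> mg gf; apply: (ge0_vanishing mg); first by move=> y; case/andP: (gf y).
  apply: le_lt_trans fy; apply: modular_le => // y.
  by have /andP[g0 ?] := gf y; rewrite ger0_norm.
have -> : f = (fp \+ (fun y : borel S => (-1 : R) * fn y))%R.
  apply/funext => y; rewrite /fp /fn /=.
  by case: (leP (f y) 0%R) => h; case: (leP (- f y)%R 0%R) => h'; lra.
have vp : vanishing fp.
  apply: H => // y; rewrite /fp le_max lexx orbT/= ge_max normr_ge0 andbT.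
  exact: ler_norm.
have vn : vanishing fn.
  apply: H => // y; rewrite /fn le_max lexx orbT/= ge_max normr_ge0 andbT.
  by rewrite -normrN ler_norm.
have mfn' : measurable_fun setT (fun y : borel S => (-1 : R) * fn y)%R.
  by apply: measurable_funM => //; exact: measurable_cst.
apply: (vanishingD mu_doubling p_gt0 p0_gt1 mfp mfn' vp).
exact: (vanishingZ mu_doubling p0_gt1 (-1)%R mfn vn).
Qed.

End dense_class.

(** * Necessity of the conditions *)

Section esup.
Context (R : realType) (T : Type) (K : set T).
Local Open Scope ereal_scope.

Lemma esup_ge0_ge0 (G : T -> \bar R) : 0 <= esup_ge0 K G.
Proof. by apply: ereal_sup_ubound; left. Qed.

Lemma esup_ge0_ub (G : T -> \bar R) f : K f -> G f <= esup_ge0 K G.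
Proof. by move=> Kf; apply: ereal_sup_ubound; right; exists f. Qed.

Lemma esup_ge0_le (G : T -> \bar R) (a : \bar R) : 0 <= a ->
  (forall f, K f -> G f <= a) -> esup_ge0 K G <= a.
Proof. by move=> a0 Ga; apply: ge_ereal_sup => _ [->//|[f Kf <-]]; exact: Ga. Qed.

Lemma esup_ge0_cvg0P (I : Type) (F : set_system I) (G : I -> T -> \bar R) :
  Filter F ->
  (esup_ge0 K (G i) @[i --> F] --> 0) <->
  (forall e : R, (0 < e)%R -> \forall i \near F, forall f, K f -> G i f <= e%:E).
Proof.
move=> FF; split=> [G0 e e0|H].
  have oe : nbhs (0 : \bar R) [set y | y < e%:E].
    by apply: open_nbhs_nbhs; split; [exact: open_ereal_lt_ereal|rewrite /= lte_fin].
  have Ge : \forall i \near F, esup_ge0 K (G i) < e%:E := G0 _ oe.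
  apply: filterS Ge => i Gi f Kf.
  by rewrite (le_trans (esup_ge0_ub _ Kf))// ltW.
have near_le (e : R) : (0 < e)%R -> \forall i \near F, esup_ge0 K (G i) <= e%:E.
  move=> e0; apply: filterS (H e e0) => i Gi.
  by apply: esup_ge0_le => //; rewrite lee_fin ltW.
apply/fine_cvgP; split.
  apply: filterS (near_le 1%R ltr01) => i Gi.
  by rewrite ge0_fin_numE ?esup_ge0_ge0// (le_lt_trans Gi)// ltry.
apply/cvgrPdist_le => e e0; apply: filterS (near_le e e0) => i Gi.
rewrite /= sub0r normrN ger0_norm ?fine_ge0 ?esup_ge0_ge0//.
by rewrite -lee_fin fineK// ge0_fin_numE ?esup_ge0_ge0// (le_lt_trans Gi)// ltry.
Qed.

End esup.

Section precompact_Lp.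
Context d (T : measurableType d) (R : realType).
Variables (nu : {measure set T -> \bar R}) (p : R) (p_gt0 : 0 < p).
Local Notation Lp := (Lp nu p_gt0).
Local Notation modular := (modular nu p).

(** Compactness in the form of near coverings: a property that holds eventually,
    uniformly on a neighbourhood of each point, holds eventually on the whole
    compact set. *)
Lemma precompact_Lp_near (I : Type) (F : set_system I) (P : I -> Lp -> Prop)
    (K : set Lp) : Filter F -> precompact K ->
  (forall f : Lp, exists2 e : R, 0 < e & \forall i \near F,
     forall g : Lp, (modular (f \- g)%R < e%:E)%E -> P i g) ->
  \forall i \near F, K `<=` P i.
Proof.
move=> FF [U KU [/compact_near_coveringP cU _]] HP.
have : \forall i \near F, U `<=` P i.
  apply: cU => f0 _; pose f : Lp := f0; have [e e0 eP] := HP f.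
  exists ([set g : Lp | (modular (f \- g)%R < e%:E)%E],
    [set i | forall g : Lp, (modular (f \- g)%R < e%:E)%E -> P i g]).
    by split => //=; apply/(Lp_nbhsP f); exists e.
  by move=> [g i] /= [fg]; apply.
by apply: filterS => i UP g /KU; exact: UP.
Qed.

End precompact_Lp.

Section necessity.
Context (R : realType) (S : completeMetricType R).
Variables mu nu : {measure set (borel S) -> \bar R}.
Variable C : R.
Hypothesis mu_doubling : doubling_with mu C.
Hypothesis nu_ball_lty : forall (x : S) (r : R), (nu (ball x r) < +oo)%E.
Hypothesis nu_ball_gt0 : forall (x : S) (r : R), 0 < r -> (0 < nu (ball x r))%E.
Variables p p0 M : R.
Hypotheses (p_gt0 : 0 < p) (p0_gt1 : 1 < p0) (M_gt0 : 0 < M).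
Hypothesis nu_mean : ball_mean_bound mu nu p0 M.
Local Open Scope ereal_scope.
Local Notation Lp := (Lp nu p_gt0).
Local Notation modular := (modular nu p).
Local Notation total_osc := (total_osc mu nu p p0).
Variable K : set Lp.
Hypothesis preK : precompact K.

Lemma modular_near_lt (f : Lp) (b : R) : modular f < b%:E ->
  forall g : Lp, modular (f \- g)%R < b%:E ->
  modular g <= (2 `^ p * (b + b))%:E.
Proof.
move=> fb g fg; rewrite modularBC in fg.
exact: (modular_split_le p_gt0 (measurable_Lp g) (measurable_Lp f) (ltW fg) (ltW fb)).
Qed.

Lemma precompact_bounded : exists b : R, forall f, K f -> modular f <= b%:E.
Proof.
have : \forall n \near \oo, K `<=` [set f : Lp | modular f <= n%:R%:E].
  apply: (precompact_Lp_near _ preK) => f.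
  have fy := modular_Lp_lty f.
  pose b : R := (fine (modular f) + 1)%R.
  have fb : modular f < b%:E.
    rewrite -(@fineK _ (modular f)) ?ge0_fin_numE ?modular_ge0// lte_fin.
    by rewrite /b ltrDl.
  have b0 : (0 < b)%R by rewrite /b ltr_wpDl// fine_ge0// modular_ge0.
  exists b => //; exists (Num.trunc (2 `^ p * (b + b))).+1 => // n /= nb g fg.
  apply: (le_trans (modular_near_lt fb fg)); rewrite lee_fin ltW//.
  by rewrite (lt_le_trans (truncnS_gt _))// ler_nat.
move=> [n _ /(_ n (leqnn n)) Kn]; exists n%:R => f /Kn.
by [].
Qed.

(** Up to the factor 2^p, passing from f to g changes the tail outside any ball
    by at most the modular of f - g. *)
Lemma precompact_tail (x0 : S) (e : R) : (0 < e)%R ->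
  \forall A \near +oo%R, K `<=` [set f : Lp |
    modular (f \* \1_(~` ball x0 A))%R <= e%:E].
Proof.
move=> e0; apply: (precompact_Lp_near _ preK) => f.
have mf := measurable_Lp f.
have mB A : measurable (ball x0 A : set (borel S)) by exact: measurable_metric_ball.
have mBc A : measurable (~` ball x0 A : set (borel S)) by exact: measurableC.
have k0 : (0 < 2 `^ p :> R)%R by rewrite powR_gt0.
pose h : R := (e / (2 `^ p * 2))%R.
have h0 : (0 < h)%R by rewrite divr_gt0// mulr_gt0.
pose f_ n (y : borel S) : R := (f y * \1_(ball x0 n%:R) y)%R.
have mf_ n : measurable_fun setT (f_ n).
  by apply: measurable_funM => //; exact: measurable_indic.
have [n fn] : exists n, modular (f \- f_ n)%R <= h%:E.
  apply: (modular_dominated p_gt0 mf_ mf mf _ _ (modular_Lp_lty f) h0).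
  - move=> y; rewrite -[X in _ --> X]mulr1; apply: cvgM; first exact: cvg_cst.
    apply: cvg_near_cst.
    exists (Num.trunc (mdist x0 y)).+1 => // n /= kn.
    rewrite indicE mem_set// ball_mdist (lt_le_trans (truncnS_gt _))//.
    by rewrite ler_nat.
  - move=> n y; rewrite /f_ indicE normrM.
    by case: (y \in _); rewrite ?normr1 ?mulr1// normr0 mulr0.
exists h => //; exists n%:R; split; first exact: num_real.
move=> A nA g fg; have mg := measurable_Lp g.
have mfA : measurable_fun setT (f \* \1_(~` ball x0 A) : borel S -> R)%R.
  by apply: measurable_funM => //; exact: measurable_indic.
have mgA : measurable_fun setT (g \* \1_(~` ball x0 A) : borel S -> R)%R.
  by apply: measurable_funM => //; exact: measurable_indic.
have gf : modular ((g \* \1_(~` ball x0 A)) \- (f \* \1_(~` ball x0 A)))%R <= h%:E.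
  apply: le_trans (ltW fg); rewrite [leRHS]modularBC; apply: modular_le => //.
  - exact: measurable_funB.
  - exact: measurable_funB.
  move=> y /=; rewrite -mulrBl normrM indicE.
  by case: (y \in _); rewrite ?normr1 ?mulr1// normr0 mulr0.
have fA : modular (f \* \1_(~` ball x0 A))%R <= h%:E.
  apply: le_trans fn; apply: modular_le => //; first exact: measurable_funB.
  move=> y; rewrite /f_ /= !indicE.
  have [yn|yn] := pselect (ball x0 n%:R y).
    rewrite memNset ?mulr0 ?normr0//.
    by apply; apply: le_ball yn; exact: ltW.
  rewrite (memNset yn) mulr0 subr0 normrM.
  by case: (y \in _); rewrite ?normr1 ?mulr1// normr0 mulr0.
rewrite /=; apply: (le_trans (modular_split_le p_gt0 mgA mfA gf fA)).
by rewrite lee_fin (_ : _ * _ = e)%R// /h; field; rewrite gt_eqF.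
Qed.

(** For g near f, write g = (g - f) + f: the oscillation of g - f is bounded by
    its modular at every scale, and that of the single function f vanishes. *)
Lemma precompact_total_osc (e : R) : (0 < e)%R ->
  \forall r \near 0^'+, K `<=` [set f : Lp | total_osc r f <= e%:E].
Proof.
move=> e0; apply: (precompact_Lp_near _ preK) => f.
have mf := measurable_Lp f.
have Co_gt0 := osc_const_gt0 p p0.
have Cm_gt0 := modular_const_gt0 mu_doubling p p0 M_gt0.
pose h : R := (e / (osc_const p p0 * 2))%R.
have h0 : (0 < h)%R by rewrite divr_gt0// mulr_gt0.
have [d d0 fd] := finite_modular_vanishing mu_doubling nu_ball_lty nu_ball_gt0
  p_gt0 p0_gt1 M_gt0 nu_mean mf (modular_Lp_lty f) h0.
exists (h / modular_const C p p0 M)%R; first by rewrite divr_gt0.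
near=> r => g fg; have mg := measurable_Lp g.
have r0 : (0 < r)%R by [].
have mgf : measurable_fun setT (g \- f : borel S -> R)%R by exact: measurable_funB.
have gE : (g : S -> R) = ((g \- f) \+ f)%R by apply/funext => y /=; rewrite subrK.
change (total_osc r g <= e%:E); rewrite [X in total_osc r X]gE.
apply: (le_trans (total_oscD nu mu_doubling p_gt0 p0_gt1 r mgf mf)).
apply: (@le_trans _ _ ((osc_const p p0)%:E * (h%:E + h%:E))); last first.
  change ((osc_const p p0 * (h + h))%:E <= e%:E); rewrite lee_fin.
  by rewrite (_ : _ * _ = e)%R// /h; field; rewrite gt_eqF.
rewrite lee_pmul2l ?lte_fin//; apply: leeD.
  apply: (le_trans (total_osc_le_modular mu_doubling nu_ball_lty nu_ball_gt0 p_gt0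
    p0_gt1 M_gt0 nu_mean r0 mgf)).
  rewrite modularBC muleC -lee_pdivlMr//.
  exact: ltW.
by apply: fd; rewrite r0/=; near: r; exact: nbhs_right_lt.
Unshelve. all: by end_near. Qed.

End necessity.

(** * The compactness criterion *)

Theorem theorem1p14 (R : realType) (S : completeMetricType R)
    (mu : {measure set (borel S) -> \bar R})
    (mu_doubling : doubling mu) (mu_cont : metrically_continuous mu)
    (x0 : S) (p : R) (p_gt0 : 0 < p)
    (w : weight mu)
    (p0 : R) (p0_gt1 : 1 < p0) (w_Ap0 : muckenhoupt mu p0 w)
    (K : set (Lp (weighted_measure w) p_gt0)) :
  precompact K <->
  [/\ Lpw_bounded K,
      Lpw_vanishing_at_infinity x0 K &
      Lpw_equicontinuous p0 K].
Proof.
have [C muC] := mu_doubling.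
have [M [M0 nu_lty nu_mean]] := muckenhoupt_ball_mean muC p0_gt1 w_Ap0.
pose nu : {measure set (borel S) -> \bar R} := weighted_measure w.
have nu_gt0 : forall (x : S) (r : R), 0 < r -> (0 < nu (ball x r))%E.
  by move=> x r; exact: (weighted_ball_gt0 w muC x).
have oscE r (f : Lp nu p_gt0) :
    oscillation w p p0 r f = total_osc mu nu p p0 r f.
  by apply: (oscillationE w muC); exact: measurable_Lp.
split=> [preK|[Kb Kt Ko]].
  split.
  - have [b Hb] := precompact_bounded preK.
    pose b1 : R := `|b| + 1.
    have b10 : 0 < b1 by rewrite ltr_wpDl.
    apply: (@le_lt_trans _ _ ((b1 `^ p^-1)%:E)); last exact: ltry.
    apply: esup_ge0_le => [|f Kf]; first by rewrite lee_fin powR_ge0.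
    apply/ltW/(Lnorm_lt _ p_gt0); first exact: powR_ge0.
    rewrite -powRrM mulVf ?gt_eqF// powRr1 ?(ltW b10)//.
    apply: (le_lt_trans (Hb f Kf)); rewrite lte_fin /b1.
    by rewrite (le_lt_trans (ler_norm b))// ltrDl.
  - apply/esup_ge0_cvg0P => e e0.
    have e20 : 0 < (e / 2) `^ p by rewrite powR_gt0// divr_gt0.
    have := precompact_tail preK x0 e20; apply: filterS => A HA f Kf.
    apply/ltW/(Lnorm_lt _ p_gt0); first exact: ltW.
    apply: (le_lt_trans (HA f Kf)); rewrite lte_fin.
    by rewrite gt0_ltr_powR// ?nnegrE ?divr_ge0 ?(ltW e0)//; lra.
  - apply/esup_ge0_cvg0P => e e0.
    have := precompact_total_osc muC nu_lty nu_gt0 p0_gt1 M0 nu_mean preK e0.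
    by apply: filterS => r Hr f Kf; rewrite oscE; exact: Hr.
apply: finitely_approximable_precompact.
apply: (@conditions_finitely_approximable _ _ mu nu C muC nu_lty p p0 p_gt0 p0_gt1 K x0).
- move: Kb; rewrite /Lpw_bounded.
  have := esup_ge0_ge0 K (fun f : Lp nu p_gt0 => Lpw_norm w p f).
  case: (esup_ge0 K _) (@esup_ge0_ub _ _ K (fun f : Lp nu p_gt0 => Lpw_norm w p f)) => // b Hb b0 _.
  exists ((b + 1) `^ p) => f Kf; apply: ltW; rewrite lee_fin in b0.
  apply/(Lnorm_lt _ p_gt0); first by rewrite addr_ge0.
  by apply: (le_lt_trans (Hb f Kf)); rewrite lte_fin ltrDl.
- move=> e e0; have ep0 : 0 < (e `^ p^-1) / 2 by rewrite divr_gt0// powR_gt0.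
  move/esup_ge0_cvg0P : Kt => /(_ _ ep0) Kt.
  have [A [A0 HA]] := filter_ex (filterI (nbhs_pinfty_gt (num_real 0)) Kt).
  exists A => // f Kf; apply: ltW.
  have -> : e = (e `^ p^-1) `^ p by rewrite -powRrM mulVf ?gt_eqF// powRr1// ltW.
  apply/(Lnorm_lt _ p_gt0); first exact: powR_ge0.
  apply: (le_lt_trans (HA f Kf)); rewrite lte_fin.
  have : 0 < e `^ p^-1 by rewrite powR_gt0.
  by lra.
move=> e e0; move/esup_ge0_cvg0P : Ko => /(_ _ e0) Ko.
have [r [r0 Hr]] := filter_ex (filterI (nbhs_right_gt 0) Ko).
by exists r => // f Kf; rewrite -oscE; exact: Hr.
Qed.
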